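(* Let $X:=W^{DT}_{(1,0)}$ and $Y:=W^{DT}_{(0,1)}$ be the elementary limits of a large two-color discrete time Pólya urn process with replacement matrix $R=\begin{pmatrix}a&b\\c&d\end{pmatrix}$, where $S=a+b=c+d$ and $m=a-c=d-b\in\left]\frac S2,S\right[$ are the eigenvalues of $R$. Let $\varphi_X(t)=\mathbb E\left(e^{itX}\right)$ and $\varphi_Y(t)=\mathbb E\left(e^{itY}\right)$ for $t\in\mathbb R$. Then: (i) the support of $X$ and $Y$ is the whole real line $\mathbb R$; (ii) for any $\rho\in\left]0,\frac{a+1}m\right[$, there exists $C>0$ such that for any $t\in\mathbb R\setminus\{0\}$, $\left|\varphi_X(t)\right|\le\dfrac{C}{|t|^{\rho}}$; (iii) for any $\rho\in\left]0,\frac{d+1}m\right[$, there exists $C>0$ such that for any $t\in\mathbb R\setminus\{0\}$, $\left|\varphi_Y(t)\right|\le\dfrac{C}{|t|^{\rho}}$; (iv) $X$ and $Y$ are absolutely continuous with respect to Lebesgue measure, and their densities are bounded and continuous on $\mathbb R$.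
   Context: Standing assumptions on the urn: $a,b,c,d$ are nonnegative integers with $a+b=c+d=:S$ (balanced), $bc\neq0$ (non triangular), $m:=a-c=d-b$, $\sigma:=m/S$, and the urn is large, i.e. $\sigma>\frac12$. Discrete time urn: start with $\alpha$ red and $\beta$ black balls, $(\alpha,\beta)\in\mathbb N^2\setminus\{(0,0)\}$. At each time step a ball is drawn uniformly at random among the balls of the urn and put back; if it is red, $a$ red and $b$ black balls are added; if it is black, $c$ red and $d$ black balls are added. $U^{DT}_{(\alpha,\beta)}(n)\in\mathbb N^2$ is the composition vector (number of red balls, number of black balls) after $n$ draws. Let $u_2(x,y)=\frac1S(bx-cy)$. It is known that the limit $$W^{DT}_{(\alpha,\beta)}:=\lim_{n\to+\infty}\frac1{n^{\sigma}}u_2\left(U^{DT}_{(\alpha,\beta)}(n)\right)$$ exists almost surely and in $L^p$ for every $p\ge1$. *)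

(* Defs.v *)
From HB Require Import structures.
From mathcomp Require Import all_boot all_order all_algebra.
From mathcomp Require Import all_classical all_reals all_analysis.
From mathcomp Require Import complex.

Set Implicit Arguments.
Unset Strict Implicit.
Unset Printing Implicit Defensive.

Import Order.TTheory GRing.Theory Num.Theory.
Import numFieldNormedType.Exports.

Local Open Scope classical_set_scope.
Local Open Scope ring_scope.

(** A composition is a pair (red, black). *)
Definition urn_add (u v : nat * nat) : nat * nat := (u.1 + v.1, u.2 + v.2)%N.

(** Composition after [n] draws from [s], when [e k] tells whether the ball
    drawn at the [k]-th step (counted from [0]) is red. *)
Fixpoint urn_state (a b c d : nat) (s : nat * nat) (e : nat -> bool) (n : nat)
    : nat * nat :=
  if n is k.+1
  then urn_add (urn_state a b c d s e k) (if e k then (a, b) else (c, d))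
  else s.

Section urn.
Variable R : realType.

Definition red_fraction (s : nat * nat) : R := s.1%:R / (s.1 + s.2)%:R.

(** [D k] is the colour of the [k]-th drawn ball ([true] for red).  Given the
    colours [e 0, ..., e n.-1] of the first [n] balls, the next one is uniform
    among the balls present, hence red with probability the proportion of red
    balls.  The conditional probability is cleared of its denominator. *)
Definition urn_draws (a b c d : nat) (s : nat * nat) {disp : measure_display}
    {T : measurableType disp} (P : probability T R)
    (D : nat -> {RV P >-> bool}) : Prop :=
  forall (n : nat) (e : nat -> bool),
    let past := [set w | forall k, (k < n)%N -> D k w = e k] in
    P (past `&` [set w | D n w = true])
    = ((red_fraction (urn_state a b c d s e n))%:E * P past)%E.

Definition urn_process (a b c d : nat) (s : nat * nat)
    {disp : measure_display} {T : measurableType disp} (P : probability T R)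
    (D : nat -> {RV P >-> bool}) (n : nat) (w : T) : nat * nat :=
  urn_state a b c d s (fun k => D k w) n.

Definition urn_S (a b : nat) : R := (a + b)%:R.

Definition urn_m (a c : nat) : R := a%:R - c%:R.

Definition urn_u2 (a b c : nat) (s : nat * nat) : R :=
  (b%:R * s.1%:R - c%:R * s.2%:R) / urn_S a b.

(** [W] is the almost sure limit of [u_2(U(n)) / n^sigma], with
    [sigma = m / S]; this determines [W] up to a null event. *)
Definition urn_limit (a b c d : nat) (s : nat * nat)
    {disp : measure_display} {T : measurableType disp} (P : probability T R)
    (D : nat -> {RV P >-> bool}) (W : {RV P >-> R}) : Prop :=
  {ae P, forall w,
    (n%:R `^ (urn_m a c / urn_S a b))^-1
      * urn_u2 a b c (urn_process a b c d s D n w) @[n --> \oo] --> W w}.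

End urn.

Section law.
Variable R : realType.

Definition expi (x : R) : R[i] := Complex (cos x) (sin x).

(** Componentwise expectation of an integrable complex random variable. *)
Definition cexpectation {disp : measure_display} {T : measurableType disp}
    (P : probability T R) (Z : T -> R[i]) : R[i] :=
  Complex (fine 'E_P[fun w => complex.Re (Z w)])
          (fine 'E_P[fun w => complex.Im (Z w)]).

Definition char_fun {disp : measure_display} {T : measurableType disp}
    (P : probability T R) (X : {RV P >-> R}) (t : R) : R[i] :=
  cexpectation P (fun w => expi (t * X w)).

Definition measure_support (mu : set R -> \bar R) : set R :=
  [set x | forall V : set R, open V -> V x -> (0 < mu V)%E].

(** A density is determined only almost everywhere: the law has a version of
    its density that is bounded and continuous. *)
Definition has_bounded_continuous_density (mu : set R -> \bar R) : Prop :=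
  exists f : R -> R,
    [/\ forall x, 0 <= f x,
        continuous f,
        exists M : R, forall x, `|f x| <= M
      & forall A : set R, measurable A ->
          mu A = (\int[lebesgue_measure]_(x in A) (f x)%:E)%E].

End law.

(* Main.v *)
Require Import Defs.
From HB Require Import structures.
From mathcomp Require Import all_boot all_order all_algebra.
From mathcomp Require Import all_classical all_reals all_analysis.
From mathcomp Require Import complex.
From mathcomp Require Import measurable_realfun.
From mathcomp Require Import ring lra.

Set Implicit Arguments.
Unset Strict Implicit.
Unset Printing Implicit Defensive.

Import Order.TTheory GRing.Theory Num.Theory.
Import numFieldNormedType.Exports.

Local Open Scope classical_set_scope.
Local Open Scope ring_scope.

(** The urn enters only through the iterates of its transition operator
    [urn_op], which give the expectations of functions of the composition
    ([urn_expectation]).  Write [S = a + b], [sigma = m / S], and call elementary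
    an urn that starts with a single ball.

    Steering.  One draw multiplies the mean of [u2] by [1 + m / |s|], so that
    [u2 / kappa n] is a martingale with [kappa n] of order [n ^ sigma].  Because
    [2 m > S], the variance that it can still acquire after time [n] tends to 0
    ([drift_var_super]).  A suitable word of draws brings [u2] next to any given
    multiple of [kappa n], with an error that does not grow with [n]
    ([reach_close]), and from there the urn stays close with probability at
    least one half.  Hence the normalised composition visits every interval with
    probability bounded below ([urn_near]).  At the limit this is the full
    support ([urn_limit_support]); at finite times it also bounds the modulus of
    the characteristic function of [u2] at [theta] by some [q < 1] when
    [|theta| * n ^ sigma] lies in [[1, 2]] ([urn_char_lt1]).

    Decay.  The urn started from [s + s'] superposes the urns started from [s]
    and [s']: suitably weighted, the generating functions in [z] of the
    characteristic functions are multiplicative in [s] ([urn_coef_conv]).  Let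
    [F] be the common coefficientwise majorant of the two elementary ones.  As
    the first draw turns one ball into [S + 1], [S F' <= F ^ (S + 1)]
    ([urn_submajorant]), with equality for [(1 - z) ^ (- 1 / S)], the case of
    characteristic functions of modulus 1.  The function [F ^ (- S)] decreases
    with slope at least [-1]; the factor [q] lost on the coefficients around
    [nu = |theta| ^ (- 1 / sigma)] therefore keeps [F] from blowing up at 1, and
    [F 1 ^ S] is at most a multiple of [nu] ([submajorant_sum]).  Put back into
    the differential inequality, this bounds [F] coefficientwise by a multiple
    of [nu ^ gam * (1 - z) ^ (- gam)] with [gam = 1 / (2 S)]
    ([submajorant_decay]).  After [k] draws the urn superposes [N = 1 + k S]
    elementary urns, and the [N]-th power of this bound gives a decay of
    exponent [N / (2 m)] for the characteristic function of the limit
    ([urn_char_decay]).  As [k] is arbitrary, so is the exponent.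

    Density.  Exponent 2 makes the characteristic function integrable.  The
    inversion integral, regularised by [exp (- eps |t|)], is the density of the
    law convolved with a Cauchy kernel; its integral over an interval is the
    expectation of a difference of arctangents, which tends to the indicator of
    the interval as [eps] tends to 0 ([char_fun_inversion]). *)

(** * Cauchy products and rising factorials *)

Section conv.
Variable K : comPzRingType.
Implicit Types u v : nat -> K.

Definition conv u v n := \sum_(i < n.+1) u i * v (n - i)%N.

(** The Leibniz rule for the coefficients of a product of power series.  It lets
    the product of two series be identified by induction on the degree as soon
    as the derivatives of the series are known. *)
Lemma conv_leibniz u v n :
  n.+1%:R * conv u v n.+1 = conv (fun k => k.+1%:R * u k.+1) v n
                          + conv u (fun k => k.+1%:R * v k.+1) n.
Proof.
rewrite /conv mulr_sumr.
have -> : \sum_(i < n.+2) n.+1%:R * (u i * v (n.+1 - i)%N) =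
   \sum_(i < n.+2) (i%:R * u i) * v (n.+1 - i)%N
   + \sum_(i < n.+2) u i * ((n.+1 - i)%N%:R * v (n.+1 - i)%N).
  rewrite -big_split; apply: eq_bigr => i _ /=.
  have {1}-> : n.+1 = (i + (n.+1 - i))%N by rewrite subnKC // -ltnS.
  by rewrite natrD; ring.
congr (_ + _).
  rewrite big_ord_recl /= !mul0r add0r.
  by apply: eq_bigr => i _; rewrite /bump /= add1n subSS.
rewrite big_ord_recr /= subnn mul0r mulr0 addr0.
by apply: eq_bigr => i _; rewrite subSn // -ltnS.
Qed.

End conv.

Section rising.
Variable R : realType.
Implicit Types x y p : R.

(** The coefficient of [z ^ n] in [(1 - z) ^ (- x)]. *)
Definition rcoef x n : R := \prod_(j < n) ((x + j%:R) / j.+1%:R).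

Lemma rcoef0 x : rcoef x 0 = 1.
Proof. by rewrite /rcoef big_ord0. Qed.

Lemma rcoefS x n : rcoef x n.+1 = rcoef x n * ((x + n%:R) / n.+1%:R).
Proof. by rewrite /rcoef big_ord_recr. Qed.

Lemma rcoef_gt0 x n : 0 < x -> 0 < rcoef x n.
Proof.
by move=> x0; apply: prodr_gt0 => i _; rewrite divr_gt0 // ltr_wpDr.
Qed.

Lemma rcoef_ge0 x n : 0 <= x -> 0 <= rcoef x n.
Proof.
by move=> x0; apply: prodr_ge0 => i _; rewrite divr_ge0 // addr_ge0.
Qed.

Lemma rcoef_deriv x n : n.+1%:R * rcoef x n.+1 = x * rcoef (x + 1) n.
Proof.
elim: n => [|n IHn].
  by rewrite rcoefS !rcoef0 mul1r addr0 divr1 mul1r mulr1.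
rewrite rcoefS mulrA [_ * rcoef _ _]mulrC -mulrA.
have -> : rcoef x n.+1 = x * rcoef (x + 1) n / n.+1%:R.
  by rewrite -IHn [_ * rcoef _ _]mulrC mulfK // pnatr_eq0.
rewrite rcoefS -[n.+2]addn1 -[n.+1]addn1 !natrD.
by field; rewrite !natr1 !pnatr_eq0.
Qed.

Lemma rcoef_conv x y n : conv (rcoef x) (rcoef y) n = rcoef (x + y) n.
Proof.
elim: n x y => [|n IHn] x y.
  by rewrite /conv big_ord1 !rcoef0 mulr1.
apply: (@mulfI _ n.+1%:R); first by rewrite pnatr_eq0.
rewrite conv_leibniz rcoef_deriv.
rewrite (_ : conv _ _ n = x * conv (rcoef (x + 1)) (rcoef y) n); last first.
  by rewrite /conv mulr_sumr; apply: eq_bigr => i _; rewrite rcoef_deriv mulrA.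
rewrite (_ : conv (rcoef x) _ n = y * conv (rcoef x) (rcoef (y + 1)) n); last first.
  rewrite /conv mulr_sumr; apply: eq_bigr => i _; rewrite rcoef_deriv; ring.
by rewrite !IHn addrA [x + 1 + y]addrAC mulrDl.
Qed.

Lemma rcoef1 n : rcoef 1 n = 1.
Proof.
rewrite /rcoef big1 // => i _.
by rewrite -[i.+1]addn1 natrD addrC divff // -natr1 -natrD pnatr_eq0 addn1.
Qed.

(** * Growth of rising factorials *)

(** Young's inequality for [y ^ p * 1]. *)
Lemma powR_bernoulli p y : 0 <= p <= 1 -> 0 <= y -> y `^ p <= 1 + p * (y - 1).
Proof.
move=> /andP[]; rewrite le_eqVlt => /predU1P[<-|p0].
  by move=> _ _; rewrite powRr0 mul0r addr0.
rewrite le_eqVlt => /predU1P[->|p1] y0.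
  by rewrite powRr1 // mul1r addrC subrK.
have q0 : 0 < 1 - p by rewrite subr_gt0.
have pV : (p^-1)^-1 + ((1 - p)^-1)^-1 = 1 by rewrite !invrK addrC subrK.
have := @conjugate_powR R (y `^ p) 1 p^-1 (1 - p)^-1
  (powR_ge0 _ _) ler01.
rewrite !invr_gt0 => /(_ p0 q0 pV).
rewrite mulr1 -powRrM divff ?gt_eqF // powRr1 // powR1 !invrK => /le_trans.
apply; lra.
Qed.

Lemma powR_quot x y p : 0 <= x -> 0 < y -> (x / y) `^ p = x `^ p / y `^ p.
Proof.
move=> x0 y0; rewrite powRM ?invr_ge0 ?(ltW y0) // -powR_inv1 ?(ltW y0) //.
by rewrite -powRrM mulN1r powRN.
Qed.

(** For a shift [p] at most 1, Bernoulli's inequality makes the ratio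
    [rcoef (x + p) n / rcoef x n] increase faster than [(n + x) ^ p] and more
    slowly than [(n - 1 + x) ^ p]. *)
Lemma rcoef_ratio_step_ge x p n : 0 < x -> 0 <= p <= 1 ->
  ((n.+1%:R + x) / (n%:R + x)) `^ p <= (x + p + n%:R) / (x + n%:R).
Proof.
move=> x0 p01; have nx0 : 0 < n%:R + x by rewrite ltr_wpDl.
apply: (le_trans (powR_bernoulli p01 _)).
  by rewrite divr_ge0 // ltW // ltr_wpDl.
rewrite le_eqVlt; apply/orP; left; apply/eqP.
rewrite -[n.+1]addn1 natrD; field.
by rewrite [_ + _]addrC gt_eqF.
Qed.

Lemma rcoef_ratio_step_le x p n : 0 < x -> 0 <= p <= 1 ->
  (x + p + n.+1%:R) / (x + n.+1%:R) <= ((n.+1%:R + x) / (n%:R + x)) `^ p.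
Proof.
move=> x0 p01; have nx0 : 0 < n%:R + x by rewrite ltr_wpDl.
have mx0 : 0 < n.+1%:R + x by rewrite ltr_wpDl.
have := @powR_bernoulli p ((n%:R + x) / (n.+1%:R + x)) p01.
rewrite divr_ge0 ?(ltW nx0) ?(ltW mx0) // => /(_ isT) B.
have -> : (n.+1%:R + x) / (n%:R + x) = ((n%:R + x) / (n.+1%:R + x))^-1.
  by rewrite invf_div.
set z := _ / (n.+1%:R + x) in B *.
have z0 : 0 < z by rewrite divr_gt0.
rewrite -(powR_inv1 (ltW z0)) -powRrM mulN1r powRN.
have xm0 : 0 < x + n.+1%:R by rewrite addrC.
rewrite ler_pdivrMr // mulrC [x + n.+1%:R]addrC ler_pdivlMr ?powR_gt0 //.
have -> : x + p + n.+1%:R = (n.+1%:R + x) * (1 + p * (1 - z)).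
  rewrite /z -[n.+1]addn1 natrD; field.
  by rewrite gt_eqF //; move: mx0; rewrite -[n.+1]addn1 natrD.
rewrite -mulrA ler_piMr ?(ltW mx0) //.
case/andP: p01 => p0 p1.
have w : (p * (1 - z)) ^+ 2 >= 0 by rewrite sqr_ge0.
have : 0 <= 1 + p * (1 - z).
  suff : z <= 1 by nra.
  by rewrite /z ler_pdivrMr // mul1r lerD2r ler_nat.
move=> h; apply: (le_trans (ler_wpM2l h B)); nra.
Qed.

(** Of order [n ^ p]: the discrete counterpart of
    [Gamma (x + n + p) / Gamma (x + n)]. *)
Definition rratio x p n := rcoef (x + p) n / rcoef x n.

Lemma rratio_gt0 x p n : 0 < x -> 0 <= p -> 0 < rratio x p n.
Proof. by move=> x0 p0; rewrite divr_gt0 // rcoef_gt0 // ltr_wpDr. Qed.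

Lemma rratio0 x p : rratio x p 0 = 1.
Proof. by rewrite /rratio !rcoef0 divr1. Qed.

Lemma rratioS x p n : 0 < x ->
  rratio x p n.+1 = rratio x p n * ((x + p + n%:R) / (x + n%:R)).
Proof.
move=> x0; rewrite /rratio !rcoefS.
have n0 : n.+1%:R != 0 :> R by rewrite pnatr_eq0.
have r0 : rcoef x n != 0 by rewrite gt_eqF // rcoef_gt0.
have xn : x + n%:R != 0 by rewrite gt_eqF // ltr_pwDl.
by move: n0; rewrite -[n.+1]addn1 natrD => n0; field; rewrite n0 xn r0.
Qed.

Lemma rratio_incr x p : 0 < x -> 0 <= p <= 1 ->
  {homo (fun n => rratio x p n / (n%:R + x) `^ p) : n m / (n <= m)%N >-> n <= m}.
Proof.
move=> x0 p01; apply/nondecreasing_seqP => n /=.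
have nx0 : 0 < n%:R + x by rewrite ltr_wpDl.
have mx0 : 0 < n.+1%:R + x by rewrite ltr_wpDl.
have := rcoef_ratio_step_ge n x0 p01; rewrite powR_quot ?(ltW mx0) //.
rewrite ler_pdivrMr ?powR_gt0 // => h.
rewrite rratioS // ler_pdivlMr ?powR_gt0 // -mulrA ler_wpM2l //.
  by apply/ltW/rratio_gt0 => //; case/andP: p01.
by rewrite ler_pdivrMl ?powR_gt0 // mulrC.
Qed.

Lemma rratio_decr x p : 0 < x -> 0 <= p <= 1 ->
  {homo (fun n => rratio x p n.+1 / (n%:R + x) `^ p)
    : n m / (n <= m)%N >-> m <= n}.
Proof.
move=> x0 p01; apply/nonincreasing_seqP => n /=.
have nx0 : 0 < n%:R + x by rewrite ltr_wpDl.
have mx0 : 0 < n.+1%:R + x by rewrite ltr_wpDl.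
have := rcoef_ratio_step_le n x0 p01; rewrite powR_quot ?(ltW mx0) //.
rewrite (rratioS _ n.+1) // => h.
have r0 : 0 <= rratio x p n.+1 by apply/ltW/rratio_gt0 => //; case/andP: p01.
move: (rratio x p n.+1) r0 => r r0.
rewrite ler_pdivrMr ?powR_gt0 // -!mulrA ler_wpM2l //.
by apply: (le_trans h); rewrite [leRHS]mulrC.
Qed.

Lemma rratioD x p q n : 0 < x -> 0 <= p ->
  rratio x (p + q) n = rratio x p n * rratio (x + p) q n.
Proof.
move=> x0 p0; rewrite /rratio addrA [RHS]mulrC mulrA divfK //.
by rewrite gt_eqF // rcoef_gt0 // ltr_wpDr.
Qed.

Let growth_small x p : 0 < x -> 0 <= p <= 1 ->
  exists k1 k2 : R, [/\ 0 < k1, 0 < k2 &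
    forall n, (0 < n)%N -> k1 * n%:R `^ p <= rratio x p n <= k2 * n%:R `^ p].
Proof.
move=> x0 p01; have /andP[p0 p1] := p01.
exists (x `^ p)^-1, (rratio x p 1 / x `^ p * (1 + x) `^ p).
have xp0 : 0 < x `^ p by rewrite powR_gt0.
split; first by rewrite invr_gt0.
  by rewrite mulr_gt0 ?powR_gt0 // ?ltr_wpDl // divr_gt0 // rratio_gt0.
move=> [//|n] _; apply/andP; split.
  have := rratio_incr x0 p01 (leq0n n.+1).
  rewrite /= rratio0 add0r ler_pdivlMr ?powR_gt0 ?ltr_wpDl // mul1r.
  apply: le_trans; rewrite ler_wpM2l ?invr_ge0 ?(ltW xp0) //.
  by rewrite ge0_ler_powR ?nnegrE // ?addr_ge0 ?ler_wpDr // ltW.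
have := rratio_decr x0 p01 (leq0n n).
rewrite /= add0r ler_pdivrMr ?powR_gt0 ?ltr_wpDl // => /le_trans; apply.
rewrite -mulrA ler_wpM2l //.
  by rewrite divr_ge0 ?powR_ge0 // ltW // rratio_gt0.
rewrite -powRM ?addr_ge0 ?(ltW x0) // ge0_ler_powR ?nnegrE //.
- by rewrite addr_ge0 // ltW.
- by rewrite mulr_ge0 // addr_ge0 // ltW.
rewrite mulrDl mul1r -[n.+1]addn1 natrD.
have : 0 <= n%:R :> R by []. nra.
Qed.

(** A shift larger than 1 is split into shifts of length at most 1. *)
Lemma rratio_growth x p : 0 < x -> 0 <= p ->
  exists k1 k2 : R, [/\ 0 < k1, 0 < k2 &
    forall n, (0 < n)%N -> k1 * n%:R `^ p <= rratio x p n <= k2 * n%:R `^ p].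
Proof.
move=> x0 p0; have [k] : exists k : nat, p <= k%:R.
  by exists (Num.truncn p).+1; apply/ltW/truncnS_gt.
elim: k x p x0 p0 => [|k IHk] x p x0 p0 pk.
  by apply: growth_small => //; rewrite p0 (le_trans pk).
have [p1|/ltW p1] := lerP p 1; first by apply: growth_small; rewrite // p0.
have [//|//|//|k1 [k2 [k10 k20 h]]] := IHk (x + 1) (p - 1).
- by rewrite ltr_wpDr.
- by rewrite subr_ge0.
- by rewrite lerBlDr natr1.
have [|l1 [l2 [l10 l20 l]]] := @growth_small x 1 x0; first by rewrite ler01 lexx.
exists (l1 * k1), (l2 * k2); split; rewrite ?mulr_gt0 // => n n0.
have -> : p = 1 + (p - 1) by rewrite addrC subrK.
rewrite rratioD // powRD; last by rewrite pnatr_eq0 -lt0n n0 implybT.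
have /andP[h1 h2] := h n n0; have /andP[h3 h4] := l n n0.
have l_ge0 : 0 <= l1 * n%:R `^ 1 by rewrite mulr_ge0 ?powR_ge0 // ltW.
have k_ge0 : 0 <= k1 * n%:R `^ (p - 1) by rewrite mulr_ge0 ?powR_ge0 // ltW.
apply/andP; split; first by rewrite [leLHS]mulrACA ler_pM.
rewrite [leRHS]mulrACA; apply: ler_pM => //; first exact: (le_trans l_ge0 h3).
exact: (le_trans k_ge0 h1).
Qed.

End rising.

(** * The transition operator of the urn *)

Section urn_operator.
Variable R : realType.
Variables a b c d : nat.
Hypothesis balanced : (a + b = c + d)%N.
Implicit Types (s : nat * nat) (f g h : nat * nat -> R) (n l : nat).

Definition urn_size s := (s.1 + s.2)%N.
Definition red s := urn_add s (a, b).
Definition black s := urn_add s (c, d).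

(** The mean of [f] over the composition reached from [s] by one draw. *)
Definition urn_op f s : R :=
  red_fraction R s * f (red s) + (1 - red_fraction R s) * f (black s).

Definition urn_iter n f := iter n urn_op f.

Lemma red_fraction_ge0 s : 0 <= red_fraction R s.
Proof. by rewrite divr_ge0. Qed.

Lemma red_fraction_le1 s : red_fraction R s <= 1.
Proof.
rewrite /red_fraction; have [->|s0] := posnP (s.1 + s.2)%N.
  by rewrite invr0 mulr0.
by rewrite ler_pdivrMr ?ltr0n // mul1r ler_nat leq_addr.
Qed.

Lemma size_red s : urn_size (red s) = (urn_size s + (a + b))%N.
Proof. by rewrite /urn_size /= addnACA. Qed.

Lemma size_black s : urn_size (black s) = (urn_size s + (a + b))%N.
Proof. by rewrite balanced /urn_size /= addnACA. Qed.

Lemma urn_iterS n f s : urn_iter n.+1 f s = urn_op (urn_iter n f) s.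
Proof. by []. Qed.

Lemma urn_iterD n l f s : urn_iter (n + l) f s = urn_iter n (urn_iter l f) s.
Proof. by rewrite /urn_iter iterD. Qed.

Lemma urn_op_le f g s : (forall s', urn_size s' = (urn_size s + (a + b))%N ->
  f s' <= g s') -> urn_op f s <= urn_op g s.
Proof.
move=> fg; rewrite lerD // ler_wpM2l ?red_fraction_ge0 ?subr_ge0
  ?red_fraction_le1 // fg // ?size_red ?size_black //.
Qed.

Lemma urn_iter_le n f g s :
  (forall s', urn_size s' = (urn_size s + n * (a + b))%N -> f s' <= g s') ->
  urn_iter n f s <= urn_iter n g s.
Proof.
elim: n s => [|n IHn] s fg; first by apply: fg; rewrite addn0.
rewrite !urn_iterS; apply: urn_op_le => s' hs'; apply: IHn => s'' hs''.
by apply: fg; rewrite hs'' hs' -addnA mulSn.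
Qed.

Lemma urn_iter_cst n (k : R) s : urn_iter n (fun=> k) s = k.
Proof.
elim: n s => [|n IHn] s //.
by rewrite urn_iterS /urn_op !IHn -mulrDl addrCA subrr addr0 mul1r.
Qed.

Lemma urn_iterDM n (k l : R) f g s :
  urn_iter n (fun s => k * f s + l * g s) s
  = k * urn_iter n f s + l * urn_iter n g s.
Proof.
elim: n s => [|n IHn] s //.
by rewrite !urn_iterS /urn_op !IHn; ring.
Qed.

Lemma urn_iter_ext n f g s : f =1 g -> urn_iter n f s = urn_iter n g s.
Proof. by move=> fg; congr (iter _ _ _ _); apply/funext. Qed.

Lemma urn_iter_ge0 n f s : (forall s, 0 <= f s) -> 0 <= urn_iter n f s.
Proof.
by move=> f0; rewrite -(urn_iter_cst n 0 s); apply: urn_iter_le => s' _.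
Qed.

End urn_operator.

(** * Fluctuations of the urn around its mean *)

Lemma powR_natr_large (R : realType) (p M : R) : 0 < p ->
  \forall n \near \oo, M <= n%:R `^ p.
Proof.
move=> p0; exists (Num.truncn (`|M| `^ p^-1)).+1 => // n /= hn.
apply: (le_trans (ler_norm M)).
have -> : `|M| = (`|M| `^ p^-1) `^ p.
  by rewrite -powRrM mulVf ?gt_eqF // powRr1.
apply: ge0_ler_powR; rewrite ?nnegrE ?(ltW p0) //.
by apply/ltW/(lt_le_trans (truncnS_gt _)); rewrite ler_nat.
Qed.

Section urn_fluctuations.
Variable R : realType.
Variables a b c d : nat.
Hypothesis balanced : (a + b = c + d)%N.
Hypothesis nontriangular : (b * c <> 0)%N.
Hypothesis large : urn_S R a b / 2 < urn_m R a c < urn_S R a b.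
Implicit Types (s : nat * nat) (f g h : nat * nat -> R) (n l : nat).

Local Notation S_ := (urn_S R a b).
Local Notation m_ := (urn_m R a c).
Local Notation sigma := (m_ / S_).
Local Notation T := (@urn_iter R a b c d).
Local Notation u2 := (@urn_u2 R a b c).

Lemma b_gt0 : (0 < b)%N.
Proof. by case: b nontriangular. Qed.

Lemma c_gt0 : (0 < c)%N.
Proof. by case: c nontriangular => //; rewrite muln0. Qed.

Lemma S_gt0 : 0 < S_.
Proof. by rewrite ltr0n addn_gt0 b_gt0 orbT. Qed.

Lemma m_gt0 : 0 < m_.
Proof.
case/andP: large => h _; apply: lt_trans h.
by rewrite divr_gt0 //; exact: S_gt0.
Qed.

Lemma sigma_gt_half : 2^-1 < sigma.
Proof.
case/andP: large => h _.
by rewrite ltr_pdivlMr ?S_gt0 // mulrC.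
Qed.

Lemma sigma_gt0 : 0 < sigma.
Proof. by rewrite divr_gt0 ?S_gt0 ?m_gt0. Qed.

Lemma sigma_lt1 : sigma < 1.
Proof. by case/andP: large => _ h; rewrite ltr_pdivrMr ?S_gt0 // mul1r. Qed.

Let SE : S_ = c%:R + d%:R.
Proof. by rewrite /urn_S balanced natrD. Qed.

Let mE : m_ = d%:R - b%:R.
Proof.
have := SE; rewrite /urn_S natrD /urn_m => h.
by apply/eqP; rewrite subr_eq addrAC eq_sym subr_eq addrC h addrC.
Qed.

Lemma u2_red s : u2 (red a b s) = u2 s + b%:R * m_ / S_.
Proof.
have := lt0r_neq0 S_gt0; rewrite /urn_u2 /urn_m; move: (urn_S R a b) => t t0.
by rewrite /= !natrD; field.
Qed.

Lemma u2_black s : u2 (black c d s) = u2 s - c%:R * m_ / S_.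
Proof.
have := lt0r_neq0 S_gt0; rewrite mE /urn_u2; move: (urn_S R a b) => t t0.
by rewrite /= !natrD; field.
Qed.

(** The mean of [u2] after [n] draws, for an urn of size 1 with [u2] equal
    to 1 at the start. *)
Definition kappa n : R := rratio S_^-1 sigma n.

Lemma kappa_gt0 n : 0 < kappa n.
Proof. by rewrite rratio_gt0 ?invr_gt0 ?S_gt0 // ltW // sigma_gt0. Qed.

Let N n : R := (1 + n * (a + b))%:R.

Let N_gt0 n : 0 < N n. Proof. by rewrite ltr0n. Qed.

Let NS n : N n.+1 = N n + S_.
Proof. by rewrite /N mulSn addnCA addnC natrD. Qed.

Lemma kappaS n : kappa n.+1 = kappa n * (1 + m_ / N n).
Proof.
rewrite /kappa rratioS ?invr_gt0 ?S_gt0 //; congr (_ * _).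
have NE : N n = 1 + n%:R * S_ by rewrite /N natrD natrM.
have := lt0r_neq0 (N_gt0 n); have := lt0r_neq0 S_gt0; rewrite NE.
move: (urn_m R a c) (urn_S R a b) => p t t0 N0.
by field; rewrite t0 /= N0.
Qed.

(** The martingale [u2 / kappa], squared around [y], plus a bound for the
    variance that it can still acquire after time [n]. *)
Definition drift_var n (y : R) s :=
  (u2 s / kappa n - y) ^+ 2 + m_ ^+ 2 / (2 * m_ - S_) * N n / kappa n ^+ 2.

(** The arithmetic of [drift_var_super]: [u] and [M] are the value of [u2] and
    the size of the urn, [k] stands for [kappa n], and [r] is the probability of
    drawing a red ball. *)
Let second_moment_step (B C t p M k u y r : R) :
  0 < t -> 0 < p -> 0 < M -> 0 < k -> 0 <= r -> r <= 1 -> 0 <= B -> 0 <= C ->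
  t < 2 * p -> B + C <= t -> B * r - C * (1 - r) = u * t / M ->
  r * (((u + B * p / t) / (k * (1 + p / M)) - y) ^+ 2
       + p ^+ 2 / (2 * p - t) * (M + t) / (k * (1 + p / M)) ^+ 2)
  + (1 - r) * (((u - C * p / t) / (k * (1 + p / M)) - y) ^+ 2
       + p ^+ 2 / (2 * p - t) * (M + t) / (k * (1 + p / M)) ^+ 2)
  <= (u / k - y) ^+ 2 + p ^+ 2 / (2 * p - t) * M / k ^+ 2.
Proof.
move=> t0 p0 M0 k0 r0 r1 B0 C0 tp BC uE.
have D0 : 0 < 2 * p - t by rewrite subr_gt0.
have q0 : 0 < 1 + p / M by rewrite ltr_wpDr // ltW // divr_gt0.
have Mp0 : M + p != 0 by rewrite gt_eqF // addr_gt0.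
have -> : r * (((u + B * p / t) / (k * (1 + p / M)) - y) ^+ 2
       + p ^+ 2 / (2 * p - t) * (M + t) / (k * (1 + p / M)) ^+ 2)
  + (1 - r) * (((u - C * p / t) / (k * (1 + p / M)) - y) ^+ 2
       + p ^+ 2 / (2 * p - t) * (M + t) / (k * (1 + p / M)) ^+ 2) =
   (u / k - y) ^+ 2
   + (r * (1 - r) * ((B + C) / t) ^+ 2 * p ^+ 2 +
     p ^+ 2 / (2 * p - t) * (M + t)) / (k * (1 + p / M)) ^+ 2.
  have -> : u = (B * r - C * (1 - r)) / t * M.
    by rewrite uE; field; rewrite !gt_eqF.
  by field; rewrite Mp0 !gt_eqF.
rewrite lerD2l ler_pdivrMr ?exprn_gt0 ?mulr_gt0 //.
have -> : p ^+ 2 / (2 * p - t) * M / k ^+ 2 * (k * (1 + p / M)) ^+ 2 =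
   p ^+ 2 / (2 * p - t) * (M + t) + p ^+ 2 + p ^+ 4 / (2 * p - t) / M.
  by field; rewrite !gt_eqF.
have bc0 : 0 <= (B + C) / t by rewrite divr_ge0 ?addr_ge0 // ltW.
have bc1 : (B + C) / t <= 1 by rewrite ler_pdivrMr // mul1r.
have q1 : ((B + C) / t) ^+ 2 <= 1 by rewrite expr_le1.
have rr : r * (1 - r) <= 1 by nra.
have rr0 : 0 <= r * (1 - r) by rewrite mulr_ge0 // subr_ge0.
have h2 : r * (1 - r) * ((B + C) / t) ^+ 2 * p ^+ 2 <= p ^+ 2.
  by rewrite ler_piMl ?sqr_ge0 // mulr_ile1 ?sqr_ge0.
have h3 : 0 <= p ^+ 4 / (2 * p - t) / M.
  by rewrite !divr_ge0 ?(ltW D0) ?(ltW M0) // ltW // exprn_gt0.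
lra.
Qed.

(** One draw adds at most [m ^ 2 / kappa n.+1 ^ 2] to the variance, and the
    second term of [drift_var] decreases by at least that amount.  It decreases
    to 0, as [kappa] grows faster than a square root, because [2 m > S]. *)
Lemma drift_var_super n y s : urn_size s = (1 + n * (a + b))%N ->
  urn_op a b c d (drift_var n.+1 y) s <= drift_var n y s.
Proof.
move=> ss; rewrite /urn_op /drift_var u2_red u2_black kappaS NS.
have Ss : (s.1 + s.2)%:R = N n by rewrite -/(urn_size s) ss.
have rE : s.1%:R = red_fraction R s * N n.
  by rewrite /red_fraction Ss divfK // gt_eqF.
have sE : s.2%:R = (1 - red_fraction R s) * N n.
  by rewrite mulrBl mul1r -rE -Ss natrD addrC addKr.
apply: second_moment_step; rewrite ?S_gt0 ?m_gt0 ?N_gt0 ?kappa_gt0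
  ?red_fraction_ge0 ?red_fraction_le1 //.
- by case/andP: large => h _; move: h; lra.
- by have := m_gt0; rewrite SE mE; lra.
- rewrite /urn_u2 rE sE; have := lt0r_neq0 S_gt0; have := lt0r_neq0 (N_gt0 n).
  move: (N n) (urn_S R a b) (red_fraction R s) => p t r p0 t0.
  by field; rewrite p0 t0.
Qed.

Lemma drift_var_iter l n y s : urn_size s = (1 + n * (a + b))%N ->
  T l (drift_var (n + l) y) s <= drift_var n y s.
Proof.
elim: l n s => [|l IHl] n s ss; first by rewrite addn0.
apply: le_trans (drift_var_super y ss); apply: urn_op_le => // s' hs'.
rewrite addnS -addSn; apply: IHl.
by rewrite hs' ss mulSn -addnA [(_ + (a + b))%N]addnC.
Qed.

End urn_fluctuations.

(** * Compositions reached with probability bounded below *)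

Section urn_positivity.
Variable R : realType.
Variables a b c d : nat.
Hypothesis balanced : (a + b = c + d)%N.
Hypothesis nontriangular : (b * c <> 0)%N.
Hypothesis large : urn_S R a b / 2 < urn_m R a c < urn_S R a b.
Implicit Types (s e : nat * nat) (f g h : nat * nat -> R) (n l : nat).

Local Notation S_ := (urn_S R a b).
Local Notation m_ := (urn_m R a c).
Local Notation sigma := (m_ / S_).
Local Notation T := (@urn_iter R a b c d).
Local Notation u2 := (@urn_u2 R a b c).
Local Notation kappa := (kappa R a b c).

Let S0 : 0 < S_. Proof. exact: S_gt0 nontriangular. Qed.
Let m0 : 0 < m_. Proof. exact: m_gt0 nontriangular large. Qed.
Let sg0 : 0 < sigma. Proof. exact: sigma_gt0 nontriangular large. Qed.
Let sg1 : sigma < 1. Proof. exact: sigma_lt1 nontriangular large. Qed.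
Let k0 n : 0 < kappa n. Proof. exact: kappa_gt0 nontriangular large n. Qed.

(** With both colours present every word of draws has positive probability,
    and the composition reached depends only on the number [k] of red draws. *)
Lemma urn_iter_path n k s : (k <= n)%N -> (0 < s.1)%N -> (0 < s.2)%N ->
  exists2 w : R, 0 < w & forall h, (forall s', 0 <= h s') ->
    w * h (s.1 + (k * a + (n - k) * c), s.2 + (k * b + (n - k) * d))%N
    <= T n h s.
Proof.
elim: n k s => [|n IHn] k s kn s1 s2.
  exists 1 => // h h0; rewrite mul1r; move: kn; rewrite leqn0 => /eqP ->.
  by rewrite !mul0n !addn0; case: s s1 s2.
have N0 : 0 < (s.1 + s.2)%:R :> R by rewrite ltr0n addn_gt0 s1.
have Th h : (forall s', 0 <= h s') -> forall s', 0 <= T n h s'.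
  by move=> h0 s'; apply: urn_iter_ge0.
have [k_gt0|] := posnP k; last first.
  case: k kn => // k kn _.
  have [//|||w w0 hw] := IHn k (red a b s).
  - by rewrite /= addn_gt0 s1.
  - by rewrite /= addn_gt0 s2.
  have r0 : 0 < red_fraction R s by rewrite divr_gt0 // ltr0n.
  exists (red_fraction R s * w); first by rewrite mulr_gt0.
  move=> h h0; rewrite urn_iterS -mulrA; apply: ler_wpDr.
    by rewrite mulr_ge0 ?subr_ge0 ?red_fraction_le1 // Th.
  rewrite ler_wpM2l ?(ltW r0) //; apply: le_trans (hw h h0).
  by rewrite subSS !mulSn /= !addnA.
have [//|||w w0 hw] := IHn 0%N (black c d s).
- by rewrite /= addn_gt0 s1.
- by rewrite /= addn_gt0 s2.
have r1 : 0 < 1 - red_fraction R s.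
  rewrite subr_gt0 ltr_pdivrMr // mul1r ltr_nat -[ltnLHS]addn0.
  by rewrite ltn_add2l.
exists ((1 - red_fraction R s) * w); first by rewrite mulr_gt0.
move=> h h0; rewrite urn_iterS -mulrA; apply: ler_wpDl.
  by rewrite mulr_ge0 ?red_fraction_ge0 // Th.
rewrite ler_wpM2l ?(ltW r1) //; apply: le_trans (hw h h0).
by rewrite k_gt0 !subn0 !mulSn !mul0n /= !add0n !addnA.
Qed.

(** Urns with a single ball, whose first draw is deterministic. *)
Definition elementary e := e = (1, 0)%N \/ e = (0, 1)%N.

Definition after_first e := if e.1 == 1%N then red a b e else black c d e.

Lemma urn_iter_elementary n h e : elementary e ->
  T n.+1 h e = T n h (after_first e).
Proof.
by case=> ->; rewrite urn_iterS /urn_op /red_fraction /= ?addn0 ?add0n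
  ?divr1 ?mul0r ?subrr ?mul0r ?subr0 ?mul1r ?addr0 ?add0r.
Qed.

Lemma after_first_gt0 e : elementary e ->
  ((0 < (after_first e).1) && (0 < (after_first e).2))%N.
Proof.
case=> ->; rewrite /after_first /=.
  by rewrite add0n (b_gt0 nontriangular).
by rewrite add0n (c_gt0 nontriangular).
Qed.

Lemma size_after_first e : elementary e -> urn_size (after_first e) = (1 + (a + b))%N.
Proof.
case=> ->; rewrite /after_first /=; first exact: size_red.
exact: (size_black balanced (0, 1)%N).
Qed.

Lemma kappa_growth : exists k1 k2 : R, [/\ 0 < k1, 0 < k2 &
  forall n, (0 < n)%N -> k1 * n%:R `^ sigma <= kappa n <= k2 * n%:R `^ sigma].
Proof. by apply: rratio_growth; rewrite ?invr_gt0 // ltW. Qed.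

(** Squeezed between 1 and Bernoulli's bound. *)
Lemma powR_shift_cvg1 (x p : R) : 0 < x -> 0 <= p <= 1 ->
  ((n%:R + x) / n%:R) `^ p @[n --> \oo] --> (1 : R).
Proof.
move=> x0 p01; rewrite -cvg_shiftS /=.
have E n : (n.+1%:R + x) / n.+1%:R = 1 + x * harmonic n.
  by rewrite mulrDl divff ?pnatr_eq0.
have H n : 0 <= x * harmonic n by rewrite mulr_ge0 ?(ltW x0) // harmonic_ge0.
apply: (@squeeze_cvgr _ _ _ _ (cst 1) (fun n => 1 + p * (x * harmonic n))).
- apply: nearW => n; rewrite E; apply/andP; split.
    rewrite -{1}(powRr0 (1 + x * harmonic n)) ler_powR ?lerDl //.
    by case/andP: p01.
  apply: le_trans (powR_bernoulli p01 _) _; first by rewrite addr_ge0.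
  by rewrite lerD2l [1 + _ - 1]addrC addKr.
- exact: cvg_cst.
- rewrite -[X in _ --> X]addr0; apply: cvgD; first exact: cvg_cst.
  rewrite -[X in _ --> X](mulr0 p); apply: cvgMl_tmp.
  by rewrite -[X in _ --> X](mulr0 x); apply: cvgMl_tmp; exact: cvg_harmonic.
Qed.

(** [kappa n / (n + 1 / S) ^ sigma] increases and is bounded. *)
Lemma kappa_cvg : exists2 G : R, 0 < G &
  (kappa n / n%:R `^ sigma) @[n --> \oo] --> G.
Proof.
have [k1 [k2 [k10 k20 hk]]] := kappa_growth.
have S'0 : 0 < S_^-1 by rewrite invr_gt0.
have sg01 : 0 <= sigma <= 1 by rewrite !ltW.
pose v n := kappa n / (n%:R + S_^-1) `^ sigma.
have vi : {homo v : n l / (n <= l)%N >-> n <= l} by apply: rratio_incr.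
have vb : has_ubound (range v).
  exists (Num.max (v 0%N) k2) => _ [n _ <-].
  case: n => [|n]; first by rewrite le_max lexx.
  rewrite le_max; apply/orP; right.
  rewrite ler_pdivrMr ?powR_gt0 ?ltr_wpDl //.
  have /andP[_ h] := hk n.+1 isT; apply: (le_trans h).
  rewrite ler_wpM2l ?(ltW k20) // ge0_ler_powR ?nnegrE ?(ltW sg0) //.
    by rewrite addr_ge0 ?(ltW S'0).
  by rewrite lerDl ltW.
have vcv := nondecreasing_cvgn vi vb.
exists (sup (range v)).
  apply: (@lt_le_trans _ _ (v 0%N)).
    by rewrite divr_gt0 // powR_gt0 // add0r.
  by apply: ub_le_sup => //; exists 0%N.
rewrite -[X in _ --> X]mulr1.
have -> : (fun n => kappa n / n%:R `^ sigma) =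
    (fun n => v n * ((n%:R + S_^-1) / n%:R) `^ sigma).
  apply/funext => -[|n].
    by rewrite invr0 !mulr0 !powR0 ?gt_eqF // invr0 !mulr0.
  rewrite powR_quot ?addr_ge0 ?(ltW S'0) // /v mulrA divfK //.
  by rewrite gt_eqF // powR_gt0 // ltr_wpDl.
by apply: cvgM => //; exact: powR_shift_cvg1.
Qed.

Definition near_ind (q x eps : R) s : R := (`|u2 s / q - x| <= eps)%R%:R.

Lemma urn_iter_chebyshev n l (y eps : R) s : urn_size s = (1 + n * (a + b))%N ->
  0 < eps ->
  1 - drift_var a b c n y s / eps ^+ 2
    <= T l (near_ind (kappa (n + l)) y eps) s.
Proof.
move=> ss eps0; set v := @drift_var R a b c.
have e2 : 0 < eps ^+ 2 by rewrite exprn_gt0.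
apply: (@le_trans _ _
  (T l (fun s => 1 * 1 + (- (eps ^+ 2)^-1) * v (n + l)%N y s) s)).
  rewrite urn_iterDM urn_iter_cst mulr1 mulNr lerD2l lerN2 [leLHS]mulrC.
  rewrite ler_wpM2r ?invr_ge0 ?(ltW e2) //.
  exact: drift_var_iter balanced nontriangular large l n y s ss.
apply: urn_iter_le => // s' _; rewrite mulr1 /near_ind.
have D0 : 0 < 2 * m_ - S_ by case/andP: large; lra.
have vge : (u2 s' / kappa (n + l) - y) ^+ 2 <= v (n + l)%N y s'.
  rewrite lerDl divr_ge0 ?sqr_ge0 // mulr_ge0 // divr_ge0 ?sqr_ge0 //.
  exact: ltW D0.
case: (lerP `|u2 s' / kappa (n + l) - y| eps) => [_|far].
  rewrite gerDl mulNr oppr_le0 mulr_ge0 ?invr_ge0 ?(ltW e2) //.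
  by apply: le_trans vge; rewrite sqr_ge0.
rewrite mulNr subr_le0 ler_pdivlMl // mulr1.
apply: le_trans vge; rewrite -[leRHS]real_normK ?num_real //.
by rewrite lerXn2r ?nnegrE ?(ltW eps0) // ltW.
Qed.

(** Some [n0] for which the reachable values of [u2 / kappa n0] come within
    [eps] of [x] and the fluctuations after time [n0] are smaller than [eps]. *)
Lemma good_time (u x eps : R) : 0 < eps -> exists n : nat,
  [/\ m_ ^+ 2 / (2 * m_ - S_) * (1 + n.+1 * (a + b))%:R / kappa n.+1 ^+ 2
       <= eps ^+ 2 / 2,
      (b%:R + c%:R) * m_ / S_ / kappa n.+1 <= eps
    & `|x| * kappa n.+1 + `|u| <= n%:R * m_ / S_].
Proof.
move=> eps0; have [k1 [k2 [k10 k20 hk]]] := kappa_growth.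
have D0 : 0 < 2 * m_ - S_ by case/andP: large; lra.
set B := m_ ^+ 2 / (2 * m_ - S_).
have B0 : 0 <= B by rewrite mulr_ge0 ?sqr_ge0 // invr_ge0 ltW.
have e2 : 0 < eps ^+ 2 / 2 by rewrite divr_gt0 // exprn_gt0.
have sg2 : 0 < sigma * 2 - 1.
  by have := sigma_gt_half nontriangular large; lra.
have sg3 : 0 < 1 - sigma by rewrite subr_gt0.
near \oo => n.
have n1 : (1 < n)%N by near: n; exists 2%N.
have n0 : (0 < n)%N by apply: ltnW.
exists n.-1; rewrite prednK //.
have nR : 0 < n%:R :> R by rewrite ltr0n.
have np (p : R) : 0 < n%:R `^ p by rewrite powR_gt0.
have nD (p q : R) : n%:R `^ (p + q) = n%:R `^ p * n%:R `^ q.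
  by rewrite powRD // pnatr_eq0 -lt0n n0 implybT.
have /andP[hk1 hk2] := hk n n0.
have k1n : 0 < k1 * n%:R `^ sigma by rewrite mulr_gt0.
split.
- have h1 : B * (1 + S_) / k1 ^+ 2 / (eps ^+ 2 / 2) <= n%:R `^ (sigma * 2 - 1).
    by near: n; apply: powR_natr_large.
  rewrite ler_pdivrMr ?exprn_gt0 //.
  apply: (@le_trans _ _ (eps ^+ 2 / 2 * (k1 * n%:R `^ sigma) ^+ 2)); last first.
    rewrite ler_wpM2l ?(ltW e2) // lerXn2r ?nnegrE ?(ltW k1n) ?(ltW (k0 n)) //.
  have -> : (k1 * n%:R `^ sigma) ^+ 2 = k1 ^+ 2 * (n%:R `^ (sigma * 2 - 1) * n%:R).
    rewrite -[X in _ * (_ * X)](powRr1 (ltW nR)) -nD subrK exprMn.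
    by rewrite [in RHS](powRrM _ sigma) powR_mulrn // powR_ge0.
  rewrite ler_pdivrMr // ler_pdivrMr ?exprn_gt0 // in h1.
  apply: (@le_trans _ _ (B * (1 + S_) * n%:R)); last first.
    apply: le_trans (ler_wpM2r (ltW nR) h1) _.
    by rewrite le_eqVlt; apply/orP; left; apply/eqP; ring.
  rewrite -mulrA ler_wpM2l // natrD natrM -/S_ mulrDl mul1r mulrC -/(urn_S R a b).
  by rewrite mulrC lerD2r ler1n.
- have h2 : (b%:R + c%:R) * m_ / S_ / eps / k1 <= n%:R `^ sigma.
    by near: n; apply: powR_natr_large.
  rewrite ler_pdivrMr // [leRHS]mulrC -ler_pdivrMr //; apply: le_trans hk1.
  by rewrite [leRHS]mulrC -ler_pdivrMr.
- have h3 : 4 * (`|x| * k2 + 1) * S_ / m_ <= n%:R `^ (1 - sigma).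
    by near: n; apply: powR_natr_large.
  have h4 : 4 * S_ * `|u| / m_ <= n%:R `^ 1.
    by near: n; apply: powR_natr_large.
  rewrite powRr1 ?(ltW nR) // in h4.
  have np1 : n.-1%:R = n%:R - 1 :> R.
    by rewrite -subn1 natrB.
  have n2 : 2 <= n%:R :> R by rewrite ler_nat.
  have xk : `|x| * kappa n <= (`|x| * k2 + 1) * n%:R `^ sigma.
    apply: (@le_trans _ _ (`|x| * k2 * n%:R `^ sigma)).
      by rewrite -mulrA ler_wpM2l.
    by rewrite ler_wpM2r ?powR_ge0 // lerDl.
  have nE : n%:R = n%:R `^ (1 - sigma) * n%:R `^ sigma :> R.
    by rewrite -nD subrK powRr1 // ltW.
  rewrite ler_pdivrMr // in h3; rewrite ler_pdivrMr // in h4.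
  rewrite ler_pdivlMr // np1.
  have h5 : 4 * (`|x| * k2 + 1) * S_ * n%:R `^ sigma <= m_ * n%:R.
    rewrite [X in _ <= _ * X]nE [leRHS]mulrA [m_ * powR _ _]mulrC.
    by rewrite ler_wpM2r ?powR_ge0.
  have h6 : `|x| * kappa n * S_ <= (`|x| * k2 + 1) * n%:R `^ sigma * S_.
    by rewrite ler_wpM2r ?(ltW S0).
  have : 0 <= m_ * (n%:R - 2) by rewrite mulr_ge0 ?(ltW m0) // subr_ge0.
  nra.
Unshelve. all: by end_near. Qed.

(** Replacing one black draw by a red one moves [u2] by [(b + c) * m / S], and
    the two extreme words reach beyond [z] on either side. *)
Lemma reach_close (s : nat * nat) n (z : R) :
  `|z| + `|u2 s| <= n%:R * m_ / S_ ->
  exists2 k, (k <= n)%N &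
  `|u2 (s.1 + (k * a + (n - k) * c), s.2 + (k * b + (n - k) * d))%N - z|
     <= (b%:R + c%:R) * m_ / S_.
Proof.
move=> zu; set D := (b%:R + c%:R) * m_ / S_.
have bR : 1 <= b%:R :> R by rewrite ler1n (b_gt0 nontriangular).
have cR : 1 <= c%:R :> R by rewrite ler1n (c_gt0 nontriangular).
have D0 : 0 < D by rewrite !mulr_gt0 ?invr_gt0 //; lra.
have uE k : (k <= n)%N ->
    u2 (s.1 + (k * a + (n - k) * c), s.2 + (k * b + (n - k) * d))%N
    = u2 s - n%:R * (c%:R * m_ / S_) + k%:R * D.
  move=> kn; have aE : a%:R = m_ + c%:R by rewrite /urn_m subrK.
  have dE : d%:R = m_ + b%:R.
    have /(congr1 (fun i => i%:R : R)) := balanced.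
    by rewrite !natrD aE => ?; lra.
  have := lt0r_neq0 S0; rewrite /D /urn_u2; move: (urn_S R a b) => t t0.
  rewrite /= !natrD !natrM natrB // aE dE.
  by move: (urn_m R a c) => p; field.
(* The number of red draws that would give exactly [z], were it an integer. *)
pose q := (z - u2 s + n%:R * (c%:R * m_ / S_)) / D.
have mS : 0 <= n%:R * m_ / S_ by rewrite !mulr_ge0 ?invr_ge0 ?(ltW S0) ?(ltW m0).
have q0 : 0 <= q.
  rewrite divr_ge0 ?(ltW D0) //.
  have : n%:R * m_ / S_ <= n%:R * (c%:R * m_ / S_).
    by rewrite -!mulrA ler_wpM2l // ler_peMl // divr_ge0 ?ltW.
  have := ler_norm (u2 s); have := ler_norm (- z); rewrite normrN.
  lra.
have qn : q <= n%:R.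
  rewrite ler_pdivrMr // /D.
  have : n%:R * m_ / S_ <= n%:R * (b%:R * m_ / S_).
    by rewrite -!mulrA ler_wpM2l // ler_peMl // divr_ge0 ?ltW.
  have -> : n%:R * ((b%:R + c%:R) * m_ / S_)
     = n%:R * (b%:R * m_ / S_) + n%:R * (c%:R * m_ / S_) by ring.
  have := ler_norm (- u2 s); have := ler_norm z; rewrite normrN.
  lra.
have /andP[t1 t2] := truncn_itv q0.
have kn : (Num.truncn q <= n)%N.
  by rewrite -(ler_nat R); apply: le_trans t1 qn.
exists (Num.truncn q) => //; rewrite uE //.
have -> : u2 s - n%:R * (c%:R * m_ / S_) + (Num.truncn q)%:R * D - z
     = ((Num.truncn q)%:R - q) * D.
  by rewrite /q mulrBl divfK ?gt_eqF //; ring.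
rewrite normrM (gtr0_norm D0) ler_piMl ?(ltW D0) //.
rewrite distrC ger0_norm ?subr_ge0 // lerBlDr.
by apply: ltW; rewrite addrC natr1.
Qed.

Lemma near_ind_ge0 q x eps s : 0 <= near_ind q x eps s.
Proof. exact: ler0n. Qed.

Lemma near_ind_neq0 q x eps s :
  (near_ind q x eps s != 0) = (`|u2 s / q - x| <= eps).
Proof. by rewrite pnatr_eq0 eqb0 negbK. Qed.

(** The urn follows a word that brings [u2 / kappa] close to [x] at a good time
    and, by Chebyshev's inequality, stays there with probability at least one
    half. *)
Let urn_near_kappa e (x eps : R) : elementary e -> 0 < eps ->
  exists p n1, 0 < p /\
    forall n, (n1 <= n)%N -> p <= T n (near_ind (kappa n) x eps) e.
Proof.
move=> ee eps0; have e20 : 0 < eps / 2 by rewrite divr_gt0.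
have [n [gv gD gm]] := good_time (u2 (after_first e)) x e20.
have [|k kn hk] := @reach_close (after_first e) n (x * kappa n.+1).
  by rewrite normrM (gtr0_norm (k0 _)).
have /andP[s1 s2] := after_first_gt0 ee.
have [w w0 hw] := urn_iter_path kn s1 s2.
set s := (_, _) in hk hw.
have ss : urn_size s = (1 + n.+1 * (a + b))%N.
  have := size_after_first ee; rewrite /urn_size /s /=.
  move: (after_first e) => [x1 x2] /= h.
  rewrite addnACA h [(_ * a + _ + _)%N]addnACA -!mulnDr -balanced.
  by rewrite -mulnDl subnKC // mulSn addnA.
exists (w / 2), n.+1; split; first by rewrite divr_gt0.
move=> n' nn'; rewrite -(subnKC nn'); move: (n' - n.+1)%N => l {nn' n'}.
rewrite urn_iterD urn_iter_elementary //.
apply: le_trans (hw _ _); last first.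
  by move=> s'; apply: urn_iter_ge0 => // ?; exact: near_ind_ge0.
rewrite ler_wpM2l ?(ltW w0) //.
set y := u2 s / kappa n.+1.
apply: (@le_trans _ _ (T l (near_ind (kappa (n.+1 + l)) y (eps / 2)) s)).
  apply: le_trans (urn_iter_chebyshev l y ss e20).
  rewrite lerBrDr -lerBrDl ler_pdivrMr ?exprn_gt0 //.
  have -> : 1 - 2^-1 = 2^-1 :> R by lra.
  rewrite /drift_var /y subrr expr0n /= add0r mulrC.
  by rewrite mulrC [leRHS]mulrC.
apply: urn_iter_le => // s' _; rewrite /near_ind ler_nat.
set z := u2 s' / _; have [h|//] := lerP `|z - y| (eps / 2).
rewrite lt0n eqb0 negbK.
have yx : `|y - x| <= eps / 2.
  rewrite -(mulfK (lt0r_neq0 (k0 n.+1)) x) /y -mulrBl normrM.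
  rewrite (gtr0_norm (x := _^-1)) ?invr_gt0 // ler_pdivrMr //.
  apply: (le_trans hk); by rewrite ler_pdivrMr in gD.
rewrite -[z](subrK y) -addrA; apply: (le_trans (ler_normD _ _)).
by rewrite [eps in leRHS]splitr lerD.
Qed.

(** By [kappa_cvg] the normalisation by [kappa n] can be traded for [n ^ sigma]. *)
Lemma urn_near e (x eps : R) : elementary e -> 0 < eps ->
  exists p n1, 0 < p /\
    forall n, (n1 <= n)%N -> p <= T n (near_ind (n%:R `^ sigma) x eps) e.
Proof.
move=> ee eps0; have [k1 [k2 [k10 k20 hk]]] := kappa_growth.
have [G G0 hG] := kappa_cvg.
have e1 : 0 < eps / 2 / k2 by rewrite !divr_gt0.
have [p [n1 [p0 hp]]] := @urn_near_kappa e (x / G) _ ee e1.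
have xG : (`|x / G| + 1) > 0 by rewrite ltr_wpDl.
have e2 : 0 < eps / 2 / (`|x / G| + 1) by rewrite !divr_gt0.
have /cvgrPdist_le/(_ _ e2)[n2 _ h2] := hG.
exists p, (maxn 1 (maxn n1 n2)); split=> // n.
rewrite !geq_max => /and3P[n0 n1n n2n].
apply: le_trans (hp n n1n) _; apply: urn_iter_le => // s' _.
rewrite /near_ind ler_nat.
case: (lerP `|u2 s' / kappa n - x / G| (eps / 2 / k2)) => // h.
rewrite lt0n eqb0 negbK.
have /andP[_ hk2] := hk n n0.
have ns : 0 < n%:R `^ sigma :> R by rewrite powR_gt0 // ltr0n.
have {}h2 := h2 n n2n.
have -> : u2 s' / n%:R `^ sigma - x =
  (u2 s' / kappa n - x / G) * (kappa n / n%:R `^ sigma)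
  + (x / G) * (kappa n / n%:R `^ sigma - G).
  by field; rewrite !gt_eqF.
apply: (le_trans (ler_normD _ _)); rewrite [leRHS]splitr; apply: lerD; rewrite normrM.
- rewrite -[leRHS](divfK (lt0r_neq0 k20)) ler_pM //.
  by rewrite (ger0_norm (ltW (divr_gt0 (k0 n) ns))) ler_pdivrMr.
- rewrite -[leRHS](divfK (lt0r_neq0 xG)) [leRHS]mulrC.
  by rewrite ler_pM // ?lerDl // distrC.
Qed.

(** * The characteristic function at its natural scale *)

Definition urn_char n (theta : R) s : R[i] :=
  Complex (T n (fun s' => cos (theta * u2 s')) s)
          (T n (fun s' => sin (theta * u2 s')) s).

Local Notation normc := ComplexField.Normc.normc.

(** The parallelogram inequality for the unit vectors of angles [x] and [y]
    seen from [(u, v)]: they cannot both be close to it. *)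
Let unit_vectors_apart (u v x y : R) : u ^+ 2 + v ^+ 2 = 1 ->
  (1 - cos (x - y)) / 2 <=
  (1 - (u * cos x + v * sin x)) + (1 - (u * cos y + v * sin y)).
Proof.
move=> uv; rewrite cosB.
have := cos2Dsin2 x; have := cos2Dsin2 y.
move: (cos x) (sin x) (cos y) (sin y) => c1 s1 c2 s2 h2 h1.
have := sqr_ge0 (c1 + c2 - 2 * u); have := sqr_ge0 (s1 + s2 - 2 * v).
nra.
Qed.

(** The modulus of a complex number as its real part after a rotation: moduli
    become expectations of real functions. *)
Lemma unit_direction (x y : R) : exists u v : R,
  u ^+ 2 + v ^+ 2 = 1 /\ Num.sqrt (x ^+ 2 + y ^+ 2) = u * x + v * y.
Proof.
set r := Num.sqrt _.
have r2 : r ^+ 2 = x ^+ 2 + y ^+ 2 by rewrite sqr_sqrtr // addr_ge0 ?sqr_ge0.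
have [r0|r0] := eqVneq r 0.
  exists 1, 0; split; first by rewrite expr1n expr0n addr0.
  move: r2; rewrite r0 expr0n /= => /esym/eqP.
  by rewrite paddr_eq0 ?sqr_ge0 // !sqrf_eq0 => /andP[/eqP-> /eqP->]; ring.
exists (x / r), (y / r); split.
  by rewrite !expr_div_n -mulrDl -r2 divff // sqrf_eq0.
by apply: (mulIf r0); rewrite -expr2 r2; field.
Qed.

(** At the scale where [theta * u2] is of order 1, the urn reaches with
    probability bounded below two regions whose phases differ. *)
Lemma urn_char_lt1 e : elementary e -> exists q n1, 0 < q < 1 /\
  forall n theta, (n1 <= n)%N -> 1 <= `|theta| * n%:R `^ sigma <= 2 ->
  normc (urn_char n theta e) <= q.
Proof.
move=> ee; have e0 : 0 < 8^-1 :> R by rewrite invr_gt0.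
have [p1 [n1 [p10 h1]]] := @urn_near e 0 _ ee e0.
have [p2 [n2 [p20 h2]]] := @urn_near e (2^-1) _ ee e0.
set eta : R := 1 - cos 4^-1.
have pi2 : 2 <= pi :> R by exact: pi_ge2.
have cos_lt (x y : R) : 0 <= x -> x <= pi -> 0 <= y -> y <= pi ->
    (cos x < cos y) = (y < x).
  by move=> *; rewrite ltr_cos // in_itv /=; apply/andP.
have eta0 : 0 < eta.
  by rewrite subr_gt0 -[ltRHS]cos0 cos_lt //; lra.
pose p := Num.min p1 p2.
have p0 : 0 < p by rewrite lt_min p10.
exists (Num.max (1 / 2) (1 - eta / 4 * p)), (maxn n1 n2); split.
  by rewrite lt_max divr_gt0 //= gt_max; apply/andP; split; nra.
move=> n theta; rewrite geq_max => /andP[n1n n2n] ht.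
have [u [v [uv]]] := unit_direction (complex.Re (urn_char n theta e))
  (complex.Im (urn_char n theta e)).
rewrite /urn_char /= => ->.
rewrite -urn_iterDM.
set g := fun s => u * cos (theta * u2 s) + v * sin (theta * u2 s).
have g1 s : g s <= 1.
  rewrite /g; have := cos2Dsin2 (theta * u2 s).
  move: (cos _) (sin _) => c1 s1 h.
  by have := sqr_ge0 (u - c1); have := sqr_ge0 (v - s1); nra.
have ns : n%:R `^ sigma != 0.
  apply/eqP => h; move: ht; rewrite h mulr0; lra.
(* Phases in the two regions differ by an angle in [1/4, 3/2]. *)
have dich s s' : near_ind (n%:R `^ sigma) 0 8^-1 s != 0 ->
   near_ind (n%:R `^ sigma) 2^-1 8^-1 s' != 0 ->
   eta / 2 <= (1 - g s) + (1 - g s').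
  rewrite !near_ind_neq0 => hs hs'.
  apply: le_trans (unit_vectors_apart (theta * u2 s) (theta * u2 s') uv).
  rewrite ler_pM2r ?invr_gt0 // lerD2l lerN2.
  set z := u2 s / _ in hs; set z' := u2 s' / _ in hs'.
  have -> : theta * u2 s - theta * u2 s' = (theta * n%:R `^ sigma) * (z - z').
    by rewrite /z /z'; field.
  rewrite -cos_norm normrM normrM (ger0_norm (powR_ge0 _ _)).
  move: hs hs'; rewrite !ler_norml subr0 => /andP[a1 a2] /andP[a3 a4].
  have b1 : 4^-1 <= `|z - z'| by rewrite distrC ler_normr; apply/orP; left; lra.
  have b2 : `|z - z'| <= 3 / 4 by rewrite ler_norml; apply/andP; split; lra.
  move: ht => /andP[t1 t2]; rewrite leNgt cos_lt; nra.
have concl (y p' : R) : p <= p' ->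
    p' <= T n (near_ind (n%:R `^ sigma) y 8^-1) e ->
    (forall s', near_ind (n%:R `^ sigma) y 8^-1 s' != 0 ->
       eta / 4 <= 1 - g s') ->
    T n g e <= 1 - eta / 4 * p.
  move=> pp' hp' hg.
  apply: (@le_trans _ _ (T n (fun s => 1 * 1 +
     (- (eta / 4)) * near_ind (n%:R `^ sigma) y 8^-1 s) e)); last first.
    rewrite urn_iterDM urn_iter_cst mulr1 mulNr lerD2l lerN2.
    by rewrite ler_wpM2l ?divr_ge0 ?(ltW eta0) // (le_trans pp').
  apply: urn_iter_le => // s0 _; rewrite mulr1.
  have := hg s0; rewrite /near_ind.
  case: (`|u2 s0 / n%:R `^ sigma - y| <= 8^-1) => [|_]; last first.
    by rewrite mulr0 addr0.
  by rewrite oner_eq0 mulr1 => /(_ isT); lra.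
rewrite le_max; apply/orP; right.
have [h|] := pselect (forall s', near_ind (n%:R `^ sigma) 0 8^-1 s' != 0 ->
    eta / 4 <= 1 - g s').
  by apply: (concl 0 p1) => //; [rewrite ge_min lexx | exact: h1].
move=> /existsNP[s /not_implyP[nis]] /negP; rewrite -ltNge => gs.
apply: (concl 2^-1 p2); [by rewrite ge_min lexx orbT | exact: h2 |].
move=> s' nis'; have := dich s s' nis nis'; move: gs; lra.
Qed.

End urn_positivity.

(** * A differential inequality between power series *)

Section majorant.
Variable R : realType.
Implicit Types (p q f : {poly R}) (x y : R).

Lemma le_horner_coef p q x : 0 <= x -> (forall i, p`_i <= q`_i) ->
  p.[x] <= q.[x].
Proof.
move=> x0 pq; pose n := maxn (size p) (size q).
rewrite (@horner_coef_wide _ n p) ?leq_maxl //.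
rewrite (@horner_coef_wide _ n q) ?leq_maxr //.
by apply: ler_sum => i _; rewrite ler_wpM2r ?exprn_ge0.
Qed.

Lemma coef_exp_le p q n k : (forall i, (i <= n)%N -> 0 <= p`_i <= q`_i) ->
  forall i, (i <= n)%N -> 0 <= (p ^+ k)`_i <= (q ^+ k)`_i.
Proof.
move=> pq; elim: k => [|k IHk] i iN.
  by rewrite !expr0 !coef1 lexx andbT; case: (i == _).
have jn (j : 'I_i.+1) : (j <= n)%N by apply: leq_trans iN; rewrite -ltnS.
have ijn (j : 'I_i.+1) : (i - j <= n)%N by apply: leq_trans (leq_subr _ _) iN.
rewrite !exprS !coefM; apply/andP; split.
  apply: sumr_ge0 => j _; rewrite mulr_ge0 //.
    by have /andP[] := pq j (jn j).
  by have /andP[] := IHk (i - j)%N (ijn j).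
apply: ler_sum => j _; rewrite ler_pM //.
- by have /andP[] := pq j (jn j).
- by have /andP[] := IHk (i - j)%N (ijn j).
- by have /andP[] := pq j (jn j).
- by have /andP[] := IHk (i - j)%N (ijn j).
Qed.

(** With [q := f ^+ s], the hypothesis on coefficients gives [q' <= q ^ 2] on
    the positive half-line: [1 / q] has slope at least [-1]. *)
Lemma horner_inv_slope f s x y : (0 < s)%N -> (forall i, 0 <= f`_i) -> 0 < f`_0 ->
  (forall i, s%:R * i.+1%:R * f`_i.+1 <= (f ^+ s.+1)`_i) ->
  0 <= x -> x < y ->
  (f.[x] ^+ s)^-1 - (y - x) <= (f.[y] ^+ s)^-1.
Proof.
move=> s0 f0 f00 hf x0 xy.
have fpos z : 0 <= z -> 0 < f.[z].
  move=> z0; apply: (lt_le_trans f00).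
  rewrite -[leLHS](hornerC _ z); apply: le_horner_coef => // i.
  by rewrite coefC; case: eqP => [->|].
pose q := f ^+ s.
have qpos z : 0 <= z -> 0 < q.[z] by move=> z0; rewrite horner_exp exprn_gt0 ?fpos.
have dq z : 0 <= z -> (q^`()).[z] <= q.[z] ^+ 2.
  move=> z0; rewrite /q deriv_exp hornerMn hornerM !horner_exp -exprM muln2 -addnn.
  have -> : f.[z] ^+ (s + s) = f.[z] ^+ s.-1 * f.[z] ^+ s.+1.
    by rewrite -exprD addnS -addSn prednK.
  rewrite -mulr_natl mulrA [leLHS]mulrC ler_wpM2l ?exprn_ge0 ?(ltW (fpos _ z0)) //.
  rewrite -horner_exp -hornerZ; apply: le_horner_coef => // i.
  by apply: le_trans (hf i); rewrite mulr_natr coefZ coef_deriv -mulr_natr; lra.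
have der z : z \in `]x, y[ -> is_derive z 1 (fun t => (q.[t])^-1)
     (- q.[z] ^- 2 *: (q^`()).[z]).
  rewrite in_itv /= => /andP[xz _].
  have := @is_deriveV R (horner q) z _ 1 _ (is_derive_poly q z); apply.
  by rewrite gt_eqF // qpos // ltW // (le_lt_trans x0).
have cont : {within `[x, y], continuous (fun t => (q.[t])^-1)}.
  apply: continuous_in_subspaceT => z; rewrite inE /= in_itv /= => /andP[xz _].
  apply: cvgV; last exact: continuous_horner.
  by rewrite gt_eqF // qpos // (le_trans x0).
have [z] := MVT xy der cont.
rewrite in_itv /= => /andP[xz _] E.
have z0 : 0 <= z by rewrite ltW // (le_lt_trans x0).
rewrite -!horner_exp -/q -lerBrDl.
rewrite [leRHS]E.
rewrite lerNl -[leRHS]mul1r -mulNr ler_wpM2r ?subr_ge0 ?(ltW xy) //.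
rewrite /GRing.scale /= mulNr opprK mulrC ler_pdivrMr ?exprn_gt0 ?qpos //.
by rewrite mul1r dq.
Qed.

Lemma coef_poly_rcoef_exp x n k i : (i <= n)%N ->
  ((\poly_(j < n.+1) rcoef x j) ^+ k)`_i = rcoef (k%:R * x) i.
Proof.
elim: k i => [|k IHk] i iN.
  rewrite expr0 coef1 mul0r; case: i {iN} => [|i]; first by rewrite rcoef0.
  by rewrite /rcoef big_ord_recl /= addr0 mul0r mul0r.
rewrite exprS coefM -natr1 mulrDl mul1r addrC -rcoef_conv.
apply: eq_bigr => j _; rewrite IHk ?(leq_trans (leq_subr _ _)) //.
by rewrite coef_poly (leq_trans (ltn_ord j)).
Qed.

End majorant.

Section majorant_decay.
Variable R : realType.
Implicit Types (a : nat -> R) (x nu q : R).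

Lemma rcoef_growth x : 0 < x <= 1 -> exists k1 k2 : R, [/\ 0 < k1, 0 < k2 &
  forall n, (0 < n)%N -> k1 <= rcoef x n * n%:R `^ (1 - x) <= k2].
Proof.
move=> /andP[x0 x1].
have [|k1 [k2 [k10 k20 h]]] := @rratio_growth R x (1 - x) x0.
  by rewrite subr_ge0.
exists k2^-1, k1^-1; split; rewrite ?invr_gt0 // => n n0.
have := h n n0; rewrite /rratio [x + _]addrC subrK rcoef1 div1r => /andP[h1 h2].
have c0 : 0 < rcoef x n by apply: rcoef_gt0.
have p0 : 0 < n%:R `^ (1 - x) by rewrite powR_gt0 // ltr0n.
rewrite -[rcoef x n]invrK; apply/andP; split.
  rewrite mulrC ler_pdivlMr ?invr_gt0 //.
  by rewrite ler_pdivrMl.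
rewrite mulrC ler_pdivrMr ?invr_gt0 //.
by rewrite ler_pdivlMl.
Qed.

Lemma bernoulli_expr x n : 0 <= x <= 1 -> 1 - n%:R * x <= (1 - x) ^+ n.
Proof.
move=> /andP[x0 x1]; elim: n => [|n IHn]; first by rewrite mul0r subr0 expr0.
rewrite exprS; apply: (@le_trans _ _ ((1 - x) * (1 - n%:R * x))).
  rewrite -natr1; have : 0 <= n%:R * x ^+ 2 by rewrite mulr_ge0 ?sqr_ge0.
  lra.
by rewrite ler_wpM2l ?subr_ge0.
Qed.

Variable s : nat.
Hypothesis s0 : (0 < s)%N.

Local Notation c := (rcoef (s%:R^-1 : R)).
Local Notation P a K := (\poly_(j < K.+1) a j).

(** [(1 - z) ^ (- 1 / s)], with coefficients [c], solves [s F' = F ^ (s + 1)]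
    with [F 0 = 1]; the generating function of a submajorant satisfies the
    differential inequality, stated on truncations so as to deal with
    polynomials only. *)
Definition submajorant a := [/\ a 0%N = 1, forall k, 0 <= a k <= c k &
  forall K k, (k < K)%N -> s%:R * k.+1%:R * a k.+1 <= (P a K ^+ s.+1)`_k].

Let s0R : 0 < s%:R :> R. Proof. by rewrite ltr0n. Qed.
Let c_gt0 k : 0 < c k. Proof. by rewrite rcoef_gt0 ?invr_gt0. Qed.

Let submajorant_slope a K y z : submajorant a -> 0 <= y -> y < z ->
  ((P a K).[y] ^+ s)^-1 - (z - y) <= ((P a K).[z] ^+ s)^-1.
Proof.
move=> [a0 ac ha] y0 yz; apply: horner_inv_slope => //.
- by move=> i; rewrite coef_poly; case: ifP => // _; case/andP: (ac i).
- by rewrite coef_poly /= a0.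
move=> i; have [iK|Ki] := ltnP i K.
  by rewrite coef_poly ltnS iK; apply: ha.
rewrite coef_poly ltnS ltnNge Ki /= mulr0.
have h0 : forall j, (j <= i)%N -> 0 <= (0 : {poly R})`_j <= (P a K)`_j.
  move=> j _; rewrite coef0 lexx coef_poly /=; case: ifP => // _.
  by case/andP: (ac j).
have /andP[h1 h2] := @coef_exp_le R 0 (P a K) i s.+1 h0 i (leqnn i).
exact: (le_trans h1 h2).
Qed.

Lemma submajorant_rcoef : submajorant c.
Proof.
split; first by rewrite rcoef0.
  by move=> k; rewrite lexx ltW.
move=> K k kK; rewrite coef_poly_rcoef_exp ?(ltnW kK) //.
rewrite -mulrA rcoef_deriv mulrA divff ?gt_eqF // mul1r -natr1 mulrDl mul1r.
by rewrite divff ?gt_eqF // addrC.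
Qed.

(** [F ^ (- s)] has slope at least [-1] and would reach 0 at [1] if [a] were
    [c].  The loss of a fixed proportion of the coefficients around [nu] makes
    it at [1 - 1 / (4 nu)] larger by a fixed factor, hence leaves it of order
    [1 / nu] at [1]. *)
Lemma submajorant_sum q : q < 1 -> exists2 L : R, 0 < L &
  forall nu a, submajorant a -> 2 <= nu ->
  (forall k : nat, nu <= k%:R <= 2 * nu -> a k <= q * c k) ->
  forall K, (P a K).[1] ^+ s <= L * nu.
Proof.
move=> q1.
have s1 : 0 < (s%:R^-1 : R) <= 1 by rewrite invr_gt0 s0R invf_le1 // ler1n.
have /andP[_ s1'] := s1.
have [k1 [k2 [k10 k20 hk]]] := rcoef_growth s1.
(* The relative loss at [1 - 1 / (4 nu)]. *)
pose d := Num.min (1 / 2) ((1 - q) / 16 * k1).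
have d0 : 0 < d.
  by rewrite lt_min divr_gt0 //= mulr_gt0 // divr_gt0 // subr_gt0.
exists (4 / d); first by rewrite divr_gt0.
move=> nu a sa nu2 aq K0.
have nu0 : 0 < nu by apply: lt_le_trans nu2.
(* The [l] integers from [M] on lie between [nu] and [2 * nu]. *)
pose M := (Num.truncn nu).+1; pose l := Num.truncn nu.
have /andP[l1 l2] := truncn_itv (ltW nu0).
pose K := maxn K0 (M + l).
have [a0 ac ha] := sa.
apply: (@le_trans _ _ ((P a K).[1] ^+ s)).
  have hor_ge0 k : 0 <= (P a k).[1].
    rewrite horner_poly; apply: sumr_ge0 => i _.
    by rewrite expr1n mulr1; case/andP: (ac i).
  apply: lerXn2r; rewrite ?nnegrE ?hor_ge0 //; apply: le_horner_coef => // i.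
  rewrite !coef_poly; case: ifP => iK; case: ifP => jK //.
    by move: jK; rewrite ltnS (leq_trans (_ : i <= K0)%N) ?leq_maxl.
  by case/andP: (ac i).
set t : R := (4 * nu)^-1.
have t0 : 0 < t by rewrite invr_gt0 mulr_gt0.
have tnu : t * nu = 4^-1 by rewrite /t invfM mulfVK // gt_eqF.
have t1 : t <= 8^-1.
  by rewrite /t lef_pV2 ?posrE ?mulr_gt0 //; move: nu2; lra.
have z0 : 0 <= 1 - t by lra.
have z1 : 1 - t < 1 by lra.
set Z := (4 * nu) `^ s%:R^-1.
have Z0 : 0 < Z by rewrite powR_gt0 // mulr_gt0.
have Zs : Z ^+ s = 4 * nu.
  by rewrite -powR_mulrn ?(ltW Z0) // -powRrM mulVf ?gt_eqF // powRr1 // mulr_ge0 ?ltW.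
have pos b k z : submajorant b -> 0 <= z -> 0 < (P b k).[z].
  move=> [b0 bc _] zz; rewrite horner_poly big_ord_recl b0 expr0 mulr1.
  rewrite ltr_pwDl // sumr_ge0 // => i _; rewrite mulr_ge0 ?exprn_ge0 //.
  by case/andP: (bc (lift ord0 i)).
have cZ : (P c K).[1 - t] <= Z.
  have t1' : 0 < 1 - t by lra.
  have := submajorant_slope K submajorant_rcoef (lexx 0) t1'.
  have p0 := pos c K _ submajorant_rcoef z0.
  have -> : (P c K).[0] = 1.
    by rewrite horner_coef0 coef_poly /= rcoef0.
  rewrite expr1n invr1 subr0 subKr => h.
  rewrite -(@ler_pXn2r _ s) // ?nnegrE ?(ltW p0) ?(ltW Z0) // Zs.
  by rewrite -lef_pV2 ?posrE ?exprn_gt0 ?mulr_gt0.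
have D : (P a K).[1 - t] <= (P c K).[1 - t] - d * Z.
  rewrite lerBrDr -lerBrDl !horner_poly -sumrB.
  have term0 (i : nat) : 0 <= c i * (1 - t) ^+ i - a i * (1 - t) ^+ i.
    by rewrite -mulrBl mulr_ge0 ?exprn_ge0 // subr_ge0; case/andP: (ac i).
  pose low := (1 - q) * (k1 / (4 * nu) `^ (1 - s%:R^-1)) / 2.
  have low0 : 0 <= low.
    by rewrite !divr_ge0 // mulr_ge0 ?divr_ge0 ?powR_ge0 ?subr_ge0 // ltW.
  have term1 (i : nat) : (M <= i < M + l)%N ->
      low <= c i * (1 - t) ^+ i - a i * (1 - t) ^+ i.
    move=> /andP[Mi il].
    have i0 : (0 < i)%N by apply: leq_trans Mi.
    have iR : 0 < i%:R :> R by rewrite ltr0n.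
    have nui : nu <= i%:R.
      by apply: (le_trans (ltW l2)); rewrite ler_nat.
    have inu : i%:R <= 2 * nu.
      have : i.+1%:R <= (M + l)%:R :> R by rewrite ler_nat.
      by rewrite natrD -natr1 /M -natr1 -/l; move: l1; rewrite -/l; lra.
    have ai := aq i; rewrite nui inu in ai; have {}ai := ai isT.
    rewrite -mulrBl /low ler_pM //.
    - by rewrite mulr_ge0 ?divr_ge0 ?powR_ge0 ?subr_ge0 // ltW.
    - apply: (@le_trans _ _ ((1 - q) * c i)); last by lra.
      rewrite ler_wpM2l ?subr_ge0 ?(ltW q1) // ler_pdivrMr ?powR_gt0 ?mulr_gt0 //.
      have /andP[h _] := hk i i0; apply: (le_trans h).
      rewrite ler_wpM2l ?(ltW (c_gt0 i)) // ge0_ler_powR ?nnegrE ?subr_ge0 //.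
        by rewrite mulr_ge0 // ltW.
      by move: nu0; lra.
    - apply: le_trans (bernoulli_expr i _); last by apply/andP; split; lra.
      have : i%:R * t <= 2 * nu * t by rewrite ler_wpM2r // ltW.
      rewrite -mulrA [nu * t]mulrC tnu; lra.
  have big : \sum_(M <= i < M + l) low
      <= \sum_(i < K.+1) (c i * (1 - t) ^+ i - a i * (1 - t) ^+ i).
    rewrite -(big_mkord xpredT (fun i => c i * (1 - t) ^+ i - a i * (1 - t) ^+ i)).
    have MlK : (M + l <= K.+1)%N by rewrite leqW // /K leq_maxr.
    have MK : (M <= K.+1)%N by apply: leq_trans MlK; rewrite leq_addr.
    rewrite (big_cat_nat (leq0n M) MK) /= (big_cat_nat (leq_addr l M) MlK) /=.
    rewrite ler_wpDl ?sumr_ge0 // ler_wpDr ?sumr_ge0 //.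
    by apply: ler_sum_nat => i hi; exact: term1.
  apply: le_trans big; rewrite sumr_const_nat addKn -mulr_natl.
  have lnu : nu / 2 <= l%:R by move: l2; rewrite -natr1 -/l; lra.
  apply: (@le_trans _ _ (nu / 2 * low)); last by rewrite ler_wpM2r.
  have -> : nu / 2 * low = (1 - q) / 16 * k1 * Z.
    rewrite /low /Z.
    have -> : (4 * nu) `^ (1 - s%:R^-1) = 4 * nu / Z.
      have n40 : 0 < 4 * nu by rewrite mulr_gt0.
      by rewrite powRB ?(gt_eqF n40) ?implybT // powRr1 // ltW.
    by rewrite -/Z; field; rewrite !gt_eqF.
  by rewrite ler_wpM2r ?(ltW Z0) // ge_min lexx orbT.
have fZ : (P a K).[1 - t] <= (1 - d) * Z by lra.
have d1 : d <= 1 / 2 by rewrite ge_min lexx.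
have z1' : 1 - t < 1 by [].
have := submajorant_slope K sa z0 z1'.
have p0 := pos a K _ sa z0.
have p1 := pos a K _ sa ler01.
have -> : 1 - (1 - t) = t by ring.
have pz : (P a K).[1 - t] ^+ s <= (1 - d) * (4 * nu).
  apply: (@le_trans _ _ (((1 - d) * Z) ^+ s)).
    apply: lerXn2r; rewrite ?nnegrE ?(ltW p0) // mulr_ge0 ?(ltW Z0) //; lra.
  rewrite exprMn Zs ler_wpM2r ?mulr_ge0 ?(ltW nu0) //.
  by rewrite -[leRHS]expr1 ler_wiXn2l //; lra.
move=> h; have {}pz : (1 + d) * t <= ((P a K).[1 - t] ^+ s)^-1.
  rewrite -[leLHS]invrK lef_pV2 ?posrE ?invr_gt0 ?mulr_gt0 ?exprn_gt0 //; last lra.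
  apply: (le_trans pz); rewrite invfM /t invrK ler_wpM2r ?mulr_ge0 ?(ltW nu0) //.
  by rewrite -[leRHS]mul1r ler_pdivlMr; nra.
have {}h : d * t <= ((P a K).[1] ^+ s)^-1 by lra.
have -> : 4 / d * nu = (d * t)^-1 by rewrite invfM /t invrK; field; rewrite gt_eqF.
by rewrite -[leLHS]invrK lef_pV2 ?posrE ?invr_gt0 ?exprn_gt0 // mulr_gt0.
Qed.

End majorant_decay.

Section submajorant_decay.
Variable R : realType.
Variable s : nat.
Hypothesis s0 : (0 < s)%N.
Implicit Types (a : nat -> R) (x nu q : R).

Local Notation c := (rcoef (s%:R^-1 : R)).
Local Notation P a K := (\poly_(j < K.+1) a j).
Local Notation gam := ((s.*2)%:R^-1 : R).

Let s0R : 0 < s%:R :> R. Proof. by rewrite ltr0n. Qed.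

Lemma sum_coef_le_horner1 (p : {poly R}) n : (forall i, 0 <= p`_i) ->
  \sum_(i < n.+1) p`_i <= p.[1].
Proof.
move=> p0; rewrite (@horner_coef_wide _ (maxn n.+1 (size p))) ?leq_maxr //.
under [leRHS]eq_bigr do rewrite expr1n mulr1.
rewrite -(big_mkord xpredT (fun i => p`_i)) -[leRHS](big_mkord xpredT (fun i => p`_i)).
rewrite [leRHS](big_cat_nat (leq0n n.+1) (leq_maxl _ _)) /=.
by rewrite ler_wpDr // sumr_ge0.
Qed.

(** In the convolution of [a] with the coefficients of [F ^ s] one of the two
    indices is at least [n / 2].  There the crude bounds [c j <= cm] and [1]
    apply, and the other factor is summed with the bound on [F 1]. *)
Let submajorant_step L nu a n : 0 < L -> 0 < nu -> @submajorant R s a ->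
  (forall K, (P a K).[1] ^+ s <= L * nu) -> forall cm : R, 0 <= cm ->
  (forall j, (j <= n)%N -> (n <= j.*2)%N -> c j <= cm) ->
  n.+1%:R * a n.+1 <= cm * (L * nu) + (L * nu) `^ s%:R^-1.
Proof.
move=> L0 nu0 [a0 ac ha] hL cm cm0 hcm.
have an k : 0 <= a k by case/andP: (ac k).
have Pn K k : 0 <= (P a K)`_k by rewrite coef_poly; case: ifP.
apply: (@le_trans _ _ (s%:R * n.+1%:R * a n.+1)).
  by rewrite -mulrA ler_peMl ?mulr_ge0 // ler1n.
apply: (le_trans (ha n.+1 n (ltnSn n))); rewrite exprS coefM.
set p := P a n.+1.
have pcoef k : (k <= n)%N -> p`_k = a k.
  by move=> kn; rewrite coef_poly ltnS leqW.
have Fb i : (i <= n)%N -> 0 <= (p ^+ s)`_i <= 1.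
  move=> iN; have h0 : forall j, (j <= n)%N -> 0 <= p`_j <= (P c n)`_j.
    by move=> j jn; rewrite pcoef // coef_poly ltnS jn.
  have := coef_exp_le s h0 iN; rewrite coef_poly_rcoef_exp //.
  by rewrite divff ?gt_eqF // rcoef1.
have Fn i : 0 <= (p ^+ s)`_i.
  have h0 : forall j, (j <= i)%N -> 0 <= (0 : {poly R})`_j <= p`_j.
    by move=> j _; rewrite coef0 lexx /= Pn.
  have /andP[h1 h2] := coef_exp_le s h0 (leqnn i).
  exact: (le_trans h1 h2).
apply: (@le_trans _ _ (\sum_(j < n.+1) (cm * (p ^+ s)`_(n - j) + p`_j))).
  apply: ler_sum => j _; have jn : (j <= n)%N by rewrite -ltnS.
  have /andP[F0 F1] := Fb (n - j)%N (leq_subr _ _).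
  have /andP[aj0 aj1] := ac j; rewrite pcoef //.
  have [h|h] := leqP n j.*2.
    by rewrite ler_wpDr // ler_wpM2r // (le_trans aj1) // hcm.
  by rewrite ler_wpDl ?mulr_ge0 // ler_piMr.
rewrite big_split /= -mulr_sumr; apply: lerD.
  rewrite ler_wpM2l //.
  have -> : \sum_(j < n.+1) (p ^+ s)`_(n - j) = \sum_(j < n.+1) (p ^+ s)`_j.
    by rewrite [RHS](reindex_inj rev_ord_inj); apply: eq_bigr => j _; rewrite /= subSS.
  by apply: (le_trans (sum_coef_le_horner1 n Fn)); rewrite horner_exp hL.
have Lnu : 0 <= L * nu by rewrite mulr_ge0 ?ltW.
apply: (le_trans (sum_coef_le_horner1 n (Pn n.+1))).
have h1 : 0 <= p.[1].
  by rewrite horner_poly sumr_ge0 // => i _; rewrite expr1n mulr1.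
rewrite -(@ler_pXn2r _ s) ?nnegrE ?powR_ge0 //.
by rewrite -[leRHS]powR_mulrn ?powR_ge0 // -powRrM mulVf ?gt_eqF // powRr1.
Qed.

(** The exponent [gam] is half of [1 / s]: the bound then holds on both sides of
    the scale [nu], by [a n <= c n] up to [nu] and by the step above beyond. *)
Lemma submajorant_decay q : q < 1 -> exists2 C : R, 0 < C &
  forall nu a, @submajorant R s a -> 2 <= nu ->
  (forall k : nat, nu <= k%:R <= 2 * nu -> a k <= q * c k) ->
  forall n, a n <= C * nu `^ gam * rcoef gam n.
Proof.
move=> q1; have [L L0 hL] := @submajorant_sum R s s0 q q1.
have s1 : 0 < (s%:R^-1 : R) <= 1 by rewrite invr_gt0 s0R invf_le1 // ler1n.
have gE : s%:R^-1 = gam + gam.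
  by rewrite -addnn natrD; field; rewrite !gt_eqF // addr_gt0.
have g0 : 0 < gam by rewrite invr_gt0 ltr0n double_gt0.
have /andP[_ s1'] := s1.
have g1 : 0 < gam <= 1.
  by rewrite g0 /=; move: s1' g0; rewrite gE; move: gam => y; lra.
have [k1 [k2 [k10 k20 hk]]] := rcoef_growth s1.
have [l1 [l2 [l10 l20 hl]]] := rcoef_growth g1.
pose C1 := k2 + (4 * k2 * L + L `^ s%:R^-1).
have C10 : 0 < C1.
  by rewrite !addr_gt0 ?mulr_gt0 ?powR_gt0.
exists (1 + C1 / l1) => [|nu a sa nu2 aq n].
  by rewrite addr_gt0 // divr_gt0.
have {}hL := hL nu a sa nu2 aq.
have nu0 : 0 < nu by apply: lt_le_trans nu2.
have V0 : 0 < nu `^ gam by rewrite powR_gt0.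
case: n => [|n].
  case: sa => -> _ _; rewrite rcoef0 mulr1.
  have : 1 <= nu `^ gam.
    have nu1 : 1 <= nu by lra.
    by have := ler_powR nu1 (ltW g0); rewrite powRr0.
  have : 0 < C1 / l1 by rewrite divr_gt0.
  move: (C1 / l1) (nu `^ gam) => x y; nra.
have nR : 0 < n.+1%:R :> R by rewrite ltr0n.
set X : R := n.+1%:R `^ gam; set Y : R := n.+1%:R `^ (1 - gam).
have X0 : 0 < X by rewrite powR_gt0.
have Y0 : 0 < Y by rewrite powR_gt0.
have nXY : n.+1%:R = X * Y.
  by rewrite -powRD ?pnatr_eq0 ?implybT // [gam + _]addrC subrK powRr1.
have pYX : n.+1%:R `^ (1 - s%:R^-1) = Y / X.
  by rewrite gE opprD addrA powRB // pnatr_eq0 implybT.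
have [a0 ac ha] := sa.
have /andP[an0 anc] := ac n.+1.
have an : a n.+1 * Y <= C1 * nu `^ gam.
  have [nnu|nnu] := lerP n.+1%:R nu.
    have XV : X <= nu `^ gam.
      by rewrite ge0_ler_powR ?nnegrE ?(ltW g0) ?(ltW nu0).
    have /andP[_ h] := hk n.+1 isT.
    rewrite pYX mulrA ler_pdivrMr // in h.
    apply: (@le_trans _ _ (k2 * nu `^ gam)); last first.
      by rewrite ler_wpM2r ?(ltW V0) // lerDl ltW // addr_gt0 ?powR_gt0 ?mulr_gt0.
    apply: (@le_trans _ _ (c n.+1 * Y)); first by rewrite ler_wpM2r ?(ltW Y0).
    by apply: (le_trans h); rewrite ler_wpM2l ?(ltW k20).
  have n1 : (0 < n)%N.
    rewrite -ltnS -(ltr_nat R); apply: lt_trans nnu.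
    by apply: lt_le_trans nu2; rewrite ltr1n.
  have VX : nu `^ gam <= X.
    by rewrite ge0_ler_powR ?nnegrE ?(ltW g0) ?(ltW nu0) // ltW.
  have WY : nu `^ (1 - gam) <= Y.
    rewrite ge0_ler_powR ?nnegrE ?(ltW nu0) ?(ltW nnu) //.
    by rewrite subr_ge0; case/andP: g1.
  have cm0 : 0 <= 4 * k2 * X / Y.
    by rewrite divr_ge0 ?mulr_ge0 ?(ltW k20) ?(ltW X0) ?(ltW Y0).
  have := submajorant_step L0 nu0 sa hL cm0.
  move=> /(_ n) step; have {step} : n.+1%:R * a n.+1
      <= 4 * k2 * X / Y * (L * nu) + (L * nu) `^ s%:R^-1.
    apply: step => j jn nj.
    have j0 : (0 < j)%N by case: j nj {jn} => //; rewrite leqNgt n1.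
    have jR : 0 < j%:R :> R by rewrite ltr0n.
    have /andP[_ h] := hk j j0.
    have jp : 0 < j%:R `^ (1 - s%:R^-1) :> R by rewrite powR_gt0.
    have nj4 : n.+1%:R <= 4 * j%:R :> R.
      rewrite -natrM ler_nat; apply: (@leq_trans j.*2.+1) => //.
      by rewrite (mulnDl 2 2) !mul2n -addn1 leq_add2l double_gt0.
    have s1'' : 0 <= 1 - (s%:R^-1 : R) by rewrite subr_ge0.
    have : n.+1%:R `^ (1 - s%:R^-1) <= 4 * j%:R `^ (1 - s%:R^-1) :> R.
      apply: (@le_trans _ _ ((4 * j%:R) `^ (1 - s%:R^-1))).
        by rewrite ge0_ler_powR ?nnegrE // mulr_ge0.
      rewrite powRM // ler_wpM2r ?powR_ge0 //.
      apply: ler1_powR; first by rewrite ler1n.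
      by rewrite lerBlDr lerDl invr_ge0.
    rewrite pYX => h4.
    have -> : 4 * k2 * X / Y = 4 * k2 / (Y / X) by field; rewrite !gt_eqF.
    rewrite ler_pdivlMr ?divr_gt0 //.
    apply: le_trans (ler_wpM2l _ h4) _; first by rewrite ltW // rcoef_gt0 // invr_gt0.
    by rewrite mulrCA ler_wpM2l.
  have nuE : nu = nu `^ gam * nu `^ (1 - gam).
    rewrite -powRD ?(gt_eqF nu0) ?implybT //.
    by rewrite [gam + _]addrC subrK powRr1 // ltW.
  rewrite powRM ?(ltW L0) ?(ltW nu0) //.
  have -> : nu `^ s%:R^-1 = nu `^ gam * nu `^ gam.
    by rewrite gE powRD // (gt_eqF nu0) implybT.
  rewrite [X in L * X]nuE nXY.
  set L2 := L `^ _; have L20 : 0 < L2 by rewrite powR_gt0.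
  move: (nu `^ gam) (nu `^ (1 - gam)) V0 VX WY => V W V0 VX WY h.
  have W0 : 0 <= 4 * k2 * L * V by rewrite !mulr_ge0 // ltW.
  have h1 : X * (a n.+1 * Y) <= X * (4 * k2 * L * V) + X * (L2 * V).
    rewrite [leLHS]mulrCA mulrC; apply: (le_trans h).
    apply: lerD.
      have -> : 4 * k2 * X / Y * (L * (V * W)) = X * (4 * k2 * L * V) * (W / Y).
        by field; rewrite gt_eqF.
      have WY1 : W / Y <= 1 by rewrite ler_pdivrMr // mul1r.
      by rewrite ler_piMr // mulr_ge0 // ltW.
    by rewrite mulrA mulrC ler_wpM2r ?mulr_ge0 // ?(ltW L20) ?(ltW V0).
  rewrite -mulrDr ler_pM2l // in h1; apply: (le_trans h1).
  by rewrite /C1 !mulrDl; rewrite lerDr mulr_ge0 // ltW.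
have /andP[h _] := hl n.+1 isT.
have cp : 0 < rcoef gam n.+1 by rewrite rcoef_gt0.
rewrite -/Y in h.
apply: (@le_trans _ _ (C1 / l1 * nu `^ gam * rcoef gam n.+1)); last first.
  by rewrite ler_wpM2r ?(ltW cp) // ler_wpM2r ?(ltW V0) // lerDr.
rewrite -(ler_pM2r Y0); apply: (le_trans an).
apply: (@le_trans _ _ (C1 / l1 * nu `^ gam * l1)).
  by rewrite mulrAC divfK // gt_eqF.
rewrite -[leRHS]mulrA ler_wpM2l // mulr_ge0 ?divr_ge0 ?(ltW V0) //; exact: ltW.
Qed.

End submajorant_decay.

(** * Superposition of elementary urns *)

Section urn_decay.
Variable R : realType.
Variables a b c d : nat.
Hypothesis balanced : (a + b = c + d)%N.
Hypothesis nontriangular : (b * c <> 0)%N.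
Hypothesis large : urn_S R a b / 2 < urn_m R a c < urn_S R a b.
Implicit Types (s e : nat * nat) (f g h : nat * nat -> R) (n l k : nat).
Implicit Types (theta nu : R).

Local Notation S_ := (urn_S R a b).
Local Notation m_ := (urn_m R a c).
Local Notation sigma := (m_ / S_).
Local Notation T := (@urn_iter R a b c d).
Local Notation u2 := (@urn_u2 R a b c).
Local Notation normc := ComplexField.Normc.normc.
Local Notation urn_char := (@urn_char R a b c d).
Local Notation after_first := (@after_first a b c d).
Local Notation red := (red a b).
Local Notation black := (black c d).

Let S0 : 0 < S_. Proof. exact: S_gt0 nontriangular. Qed.
Let m0 : 0 < m_. Proof. exact: m_gt0 nontriangular large. Qed.
Let sg0 : 0 < sigma. Proof. exact: sigma_gt0 nontriangular large. Qed.
Let sg1 : sigma < 1. Proof. exact: sigma_lt1 nontriangular large. Qed.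
Let SN0 : (0 < a + b)%N. Proof. by rewrite -(ltr0n R). Qed.

Let normcE (z : R[i]) :
  normc z = Num.sqrt ((complex.Re z) ^+ 2 + (complex.Im z) ^+ 2).
Proof. by case: z. Qed.

Let normc_real (x : R) : 0 <= x -> normc x%:C%C = x.
Proof. by move=> x0; rewrite /= expr0n /= addr0 sqrtr_sqr ger0_norm. Qed.

Let normc_ge0 (z : R[i]) : 0 <= normc z.
Proof. by rewrite normcE sqrtr_ge0. Qed.

Lemma urn_charE n theta s : urn_char n theta s =
  Complex (T n (fun s' => cos (theta * u2 s')) s)
          (T n (fun s' => sin (theta * u2 s')) s).
Proof. by []. Qed.

Lemma urn_char_direction n theta s : exists u v : R, u ^+ 2 + v ^+ 2 = 1 /\
  normc (urn_char n theta s)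
  = T n (fun s' => u * cos (theta * u2 s') + v * sin (theta * u2 s')) s.
Proof.
have [u [v [uv E]]] := unit_direction (complex.Re (urn_char n theta s))
  (complex.Im (urn_char n theta s)).
by exists u, v; split=> //; rewrite normcE E urn_iterDM.
Qed.

Lemma unit_direction_le (u v x y : R) : u ^+ 2 + v ^+ 2 = 1 ->
  u * x + v * y <= Num.sqrt (x ^+ 2 + y ^+ 2).
Proof.
move=> uv; apply: (le_trans (ler_norm _)); rewrite -sqrtr_sqr ler_sqrt.
  by have := sqr_ge0 (u * y - v * x); nra.
by rewrite addr_ge0 ?sqr_ge0.
Qed.

Lemma urn_char_iter_le k n theta s (B : R) :
  (forall s', urn_size s' = (urn_size s + k * (a + b))%N ->
    normc (urn_char n theta s') <= B) ->
  normc (urn_char (k + n) theta s) <= B.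
Proof.
move=> hB; have [u [v [uv ->]]] := urn_char_direction (k + n) theta s.
rewrite urn_iterD -(urn_iter_cst a b c d k B s).
apply: urn_iter_le => // s' ss'; rewrite urn_iterDM.
apply: le_trans (hB s' ss'); rewrite normcE.
exact: unit_direction_le.
Qed.

Lemma urn_char_le1 n theta s : normc (urn_char n theta s) <= 1.
Proof.
have := @urn_char_iter_le n 0 theta s 1; rewrite addn0; apply => s' _.
by rewrite normcE /= cos2Dsin2 sqrtr1.
Qed.

(** The coefficients of a generating function that is multiplicative in [s]: the
    number of histories of [n] draws of the urn is [S ^ n * n!] times the weight
    [rcoef]. *)
Definition urn_coef theta n s : R[i] :=
  (rcoef ((urn_size s)%:R / S_) n)%:C%C * urn_char n theta s.

Let coefS f n s :
  n.+1%:R * (rcoef ((urn_size s)%:R / S_) n.+1 * T n.+1 f s) =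
  s.1%:R / S_ * (rcoef ((urn_size (red s))%:R / S_) n * T n f (red s)) +
  s.2%:R / S_ * (rcoef ((urn_size (black s))%:R / S_) n * T n f (black s)).
Proof.
rewrite size_red (size_black balanced) natrD mulrDl divff ?gt_eqF //.
rewrite mulrA rcoef_deriv urn_iterS /urn_op.
set r := red_fraction R s; set x : R := (urn_size s)%:R.
have rE : s.1%:R = x * r.
  rewrite /x /r /red_fraction /urn_size; have [h|h] := posnP (s.1 + s.2)%N.
    by rewrite h mul0r; move/eqP: h; rewrite addn_eq0 => /andP[/eqP-> _].
  by rewrite mulrCA mulfV ?mulr1 // pnatr_eq0 -lt0n.
have sE : s.2%:R = x * (1 - r) by rewrite mulrBr mulr1 -rE /x natrD addrC addKr.
by rewrite rE sE; ring.
Qed.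

Lemma urn_coefS theta n s :
  n.+1%:R * urn_coef theta n.+1 s =
  (s.1%:R / S_)%:C%C * urn_coef theta n (red s) +
  (s.2%:R / S_)%:C%C * urn_coef theta n (black s).
Proof.
have natC (k : nat) : k%:R = (k%:R : R)%:C%C by rewrite rmorph_nat.
have realM (x y z : R) : x%:C%C * Complex y z = Complex (x * y) (x * z).
  by apply/eqP; rewrite eq_complex /= !mul0r subr0 addr0 !eqxx.
rewrite /urn_coef !urn_charE natC !realM.
by apply/eqP; rewrite eq_complex /= !coefS !eqxx.
Qed.

(** Balls drawn from [s] and from [s'] with their descendants form two
    independent urns once the number of draws falling in each is known.  The
    proof is the Leibniz rule: both sides solve the same recurrence. *)
Lemma urn_coef_conv theta n s s' :
  urn_coef theta n (urn_add s s') =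
  conv (fun k => urn_coef theta k s) (fun k => urn_coef theta k s') n.
Proof.
elim: n s s' => [|n IHn] s s'.
  rewrite /conv big_ord1 /urn_coef /= !rcoef0 !mul1r !urn_charE /=.
  have -> : u2 (urn_add s s') = u2 s + u2 s'.
    by rewrite /urn_u2 /= !natrD; ring.
  by apply/eqP; rewrite mulrDr cosD sinD eq_complex /= eqxx /= [eqbRHS]addrC.
apply: (@mulfI _ n.+1%:R); first by rewrite pnatr_eq0.
rewrite urn_coefS conv_leibniz.
have addR : ((urn_add s s').1%:R / S_)%:C%C
    = (s.1%:R / S_)%:C%C + (s'.1%:R / S_)%:C%C by rewrite natrD mulrDl rmorphD.
have addB : ((urn_add s s').2%:R / S_)%:C%C
    = (s.2%:R / S_)%:C%C + (s'.2%:R / S_)%:C%C by rewrite natrD mulrDl rmorphD.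
have redl : red (urn_add s s') = urn_add (red s) s'.
  by rewrite /red /urn_add /= ![(_ + _ + a)%N]addnAC ![(_ + _ + b)%N]addnAC.
have redr : red (urn_add s s') = urn_add s (red s').
  by rewrite /red /urn_add /= !addnA.
have blackl : black (urn_add s s') = urn_add (black s) s'.
  by rewrite /black /urn_add /= ![(_ + _ + c)%N]addnAC ![(_ + _ + d)%N]addnAC.
have blackr : black (urn_add s s') = urn_add s (black s').
  by rewrite /black /urn_add /= !addnA.
rewrite addR addB !mulrDl {1}redl redr {1}blackl blackr !IHn.
have convDl (x y : R[i]) u1 v1 w : conv (fun k => x * u1 k + y * v1 k) w n =
    x * conv u1 w n + y * conv v1 w n.
  by rewrite /conv !mulr_sumr -big_split; apply: eq_bigr => i _ /=; ring.
have convDr (x y : R[i]) u1 v1 w : conv w (fun k => x * u1 k + y * v1 k) n =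
    x * conv w u1 n + y * conv w v1 n.
  by rewrite /conv !mulr_sumr -big_split; apply: eq_bigr => i _ /=; ring.
have dE s1 : (fun k => k.+1%:R * urn_coef theta k.+1 s1) =
    (fun k => (s1.1%:R / S_)%:C%C * urn_coef theta k (red s1)
      + (s1.2%:R / S_)%:C%C * urn_coef theta k (black s1)).
  by apply/funext => k; rewrite urn_coefS.
by rewrite !dE convDl convDr addrACA.
Qed.

Definition urn_major theta n : R :=
  Num.max (normc (urn_coef theta n (1, 0)%N)) (normc (urn_coef theta n (0, 1)%N)).

Local Notation P theta K := (\poly_(j < K.+1) urn_major theta j).
Local Notation rc := (rcoef ((a + b)%:R^-1 : R)).

Lemma normc_urn_coef theta n s : normc (urn_coef theta n s) =
  rcoef ((urn_size s)%:R / S_) n * normc (urn_char n theta s).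
Proof.
by rewrite ComplexField.Normc.normcM normc_real // rcoef_ge0 // divr_ge0.
Qed.

Lemma le_urn_major theta n e : elementary e ->
  normc (urn_coef theta n e) <= urn_major theta n.
Proof. by case=> ->; rewrite le_max lexx ?orbT. Qed.

Lemma urn_major_ge0 theta n : 0 <= urn_major theta n.
Proof. by rewrite le_max normc_ge0. Qed.

Lemma normc_conv_le (u v : nat -> R[i]) n :
  normc (conv u v n) <= conv (fun k => normc (u k)) (fun k => normc (v k)) n.
Proof.
rewrite /conv; apply: (big_ind2 (fun x y => normc x <= y)).
- by rewrite ComplexField.Normc.normc0.
- move=> x1 x2 y1 y2 h1 h2.
  by apply: (le_trans (le_normcD _ _)); rewrite lerD.
- by move=> i _; rewrite ComplexField.Normc.normcM.
Qed.

(** Peel off the balls of [s] one at a time. *)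
Lemma urn_coef_le_major theta K n s : (n <= K)%N ->
  normc (urn_coef theta n s) <= (P theta K ^+ urn_size s)`_n.
Proof.
move=> nK; have [N hN] := ubnP (urn_size s); elim: N s n nK hN => // N IHN s n nK.
rewrite ltnS => sN; have [s0|s0] := posnP (urn_size s).
  have -> : s = (0, 0)%N.
    move: s0; case: (s) => x y /eqP.
    by rewrite addn_eq0 => /andP[/eqP /= -> /eqP /= ->].
  rewrite expr0 coef1 normc_urn_coef (_ : urn_size _ = 0%N) // mul0r.
  case: n {nK} => [|n]; first by rewrite rcoef0 mul1r urn_char_le1.
  by rewrite /rcoef big_ord_recl /= addr0 !mul0r.
have [e [s' [ee se]]] : exists e s', elementary e /\ s = urn_add e s'.
  move: s0; case: (s) => -[|x] [|y] // _.
  - by exists (0, 1)%N, (0, y)%N; split; [right|].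
  - by exists (1, 0)%N, (x, 0)%N; split; [left|].
  - by exists (1, 0)%N, (x, y.+1)%N; split; [left|].
have ss' : urn_size s = (urn_size s').+1.
  by rewrite se /urn_size; case: ee => -> /=; rewrite ?add0n ?add1n ?addnS.
rewrite ss' exprS coefM se urn_coef_conv; apply: (le_trans (normc_conv_le _ _ _)).
apply: ler_sum => j _; have jn : (j <= n)%N by rewrite -ltnS.
rewrite coef_poly ltnS (leq_trans jn nK) ler_pM ?le_urn_major //.
by apply: IHN; rewrite ?(leq_trans (leq_subr _ _)) // -ss'.
Qed.

(** An elementary urn has [a + b + 1] balls after its first, deterministic,
    draw. *)
Lemma urn_submajorant theta : submajorant (a + b) (urn_major theta).
Proof.
have elem_le e : elementary e -> forall k, normc (urn_coef theta k e) <= rc k.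
  move=> ee k; rewrite normc_urn_coef.
  have -> : (urn_size e)%:R / S_ = (a + b)%:R^-1.
    by case: ee => ->; rewrite /urn_size /= ?addn0 ?add0n mul1r.
  by rewrite ler_piMr ?urn_char_le1 // rcoef_ge0 // invr_ge0.
have l10 : elementary (1, 0)%N by left.
have l01 : elementary (0, 1)%N by right.
split.
- rewrite /urn_major !normc_urn_coef !rcoef0 !mul1r !normcE /=.
  by rewrite !cos2Dsin2 sqrtr1 maxxx.
- by move=> k; rewrite urn_major_ge0 ge_max !elem_le.
move=> K n nK.
have key e : elementary e ->
    (a + b)%:R * n.+1%:R * normc (urn_coef theta n.+1 e)
    <= (P theta K ^+ (a + b).+1)`_n.
  move=> ee; have := urn_coef_le_major theta (after_first e) (ltnW nK).
  rewrite (size_after_first balanced ee) add1n; apply: le_trans.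
  have E : n.+1%:R * urn_coef theta n.+1 e
       = (S_^-1)%:C%C * urn_coef theta n (after_first e).
    rewrite urn_coefS; case: ee => ->; rewrite /after_first /=.
      by rewrite mul0r mul0r addr0 mul1r.
    by rewrite mul0r mul0r add0r mul1r.
  have {}E : n.+1%:R * normc (urn_coef theta n.+1 e)
      = S_^-1 * normc (urn_coef theta n (after_first e)).
    have hn : normc (n.+1%:R : R[i]) = n.+1%:R.
      by rewrite -(rmorph_nat (real_complex R)) normc_real.
    move: (urn_coef _ _ e) (urn_coef _ _ (after_first e)) E => x y E.
    have := congr1 (fun z => normc z) E.
    by rewrite !ComplexField.Normc.normcM hn normc_real // invr_ge0 ltW.
  by rewrite -mulrA E mulrA divff ?gt_eqF // mul1r.
have [->|->] : urn_major theta n.+1 = normc (urn_coef theta n.+1 (1, 0)%N) \/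
    urn_major theta n.+1 = normc (urn_coef theta n.+1 (0, 1)%N).
  by rewrite {1 2}/urn_major; case: leP => _; [right|left].
- exact: key.
- exact: key.
Qed.

Local Notation gam := (((a + b).*2)%:R^-1 : R).

Let gam0 : 0 < gam. Proof. by rewrite invr_gt0 ltr0n double_gt0. Qed.

Let gam2 : gam + gam = S_^-1.
Proof.
have := S0; rewrite /urn_S -addnn natrD; move: ((a + b)%:R : R) => x x0.
by field; rewrite !gt_eqF // addr_gt0.
Qed.

(** [nu] is the number of draws after which [theta * u2] is of order 1.  For the
    urn of size [N] the coefficients of the [N]-th power of the majorant are
    those of [(1 - z) ^ (- N * gam)], to be compared with the weights of
    [urn_coef], of exponent [N / S = 2 * N * gam]. *)
Lemma urn_char_bound N : (0 < N)%N -> exists C nu0 : R, [/\ 0 < C, 0 < nu0 &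
  forall theta nu n s, urn_size s = N -> `|theta| * nu `^ sigma = 1 ->
    nu0 <= nu -> (0 < n)%N ->
    normc (urn_char n theta s) <= C * (nu / n%:R) `^ (N%:R * gam)].
Proof.
move=> N0.
have [q1 [n1 [/andP[q10 q11] h1]]] :=
  urn_char_lt1 balanced nontriangular large (or_introl (erefl (1, 0)%N)).
have [q2 [n2 [/andP[q20 q21] h2]]] :=
  urn_char_lt1 balanced nontriangular large (or_intror (erefl (0, 1)%N)).
have q1' : Num.max q1 q2 < 1 by rewrite gt_max q11.
have [C C0 hC] := @submajorant_decay R (a + b) SN0 _ q1'.
have NR : 0 < N%:R :> R by rewrite ltr0n.
have Ng : 0 < N%:R * gam by rewrite mulr_gt0.
have [k1 [k2 [k10 k20 hk]]] := rratio_growth Ng (ltW Ng).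
exists (C ^+ N / k1), (Num.max 2 (maxn n1 n2)%:R); split.
- by rewrite divr_gt0 // exprn_gt0.
- by rewrite lt_max ltr0n.
move=> theta nu n s sN hth; rewrite ge_max => /andP[nu2 nun] n0.
have nu0 : 0 < nu by apply: lt_le_trans nu2.
have hdec : forall j, urn_major theta j <= C * nu `^ gam * rcoef gam j.
  apply: hC => //; first exact: urn_submajorant.
  move=> k /andP[k_ge k_le].
  have kn : (maxn n1 n2 <= k)%N by rewrite -(ler_nat R) (le_trans nun).
  move: kn; rewrite geq_max => /andP[kn1 kn2].
  have ht : 1 <= `|theta| * k%:R `^ sigma <= 2.
    apply/andP; split.
      by rewrite -{1}hth ler_wpM2l // (ge0_ler_powR (ltW sg0)) ?nnegrE ?(ltW nu0).
    apply: (@le_trans _ _ (`|theta| * (2 * nu) `^ sigma)).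
      by rewrite ler_wpM2l // (ge0_ler_powR (ltW sg0)) ?nnegrE ?mulr_ge0 ?(ltW nu0).
    rewrite powRM // ?(ltW nu0) // mulrCA hth mulr1.
    by apply: ler1_powR; rewrite ?ler1n // ltW.
  rewrite /urn_major !normc_urn_coef /urn_size /= addn0 add0n mul1r.
  have c0 : 0 <= rc k by rewrite rcoef_ge0 // invr_ge0.
  rewrite -maxr_pMr // mulrC ler_wpM2r // ge_max !le_max h1 //= h2 //.
  by rewrite orbT.
have nuP : 0 < nu `^ gam by rewrite powR_gt0.
have D0 : 0 < C * nu `^ gam by rewrite mulr_gt0.
have := urn_coef_le_major theta s (leqnn n); rewrite sN normc_urn_coef sN.
have h0 j : (j <= n)%N -> 0 <= (P theta n)`_j <=
    ((C * nu `^ gam) *: \poly_(i < n.+1) rcoef gam i)`_j.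
  by move=> jn; rewrite coefZ !coef_poly ltnS jn urn_major_ge0 hdec.
have /andP[_ h3] := coef_exp_le N h0 (leqnn n).
move=> /le_trans/(_ h3); rewrite exprZn coefZ coef_poly_rcoef_exp //.
have -> : N%:R / S_ = N%:R * gam + N%:R * gam by rewrite -mulrDr gam2.
have r0 : 0 < rcoef (N%:R * gam) n by rewrite rcoef_gt0.
have /andP[h4 _] := hk n n0; rewrite ler_pdivlMr // in h4.
have n0R : 0 < n%:R :> R by rewrite ltr0n.
have np : 0 < n%:R `^ (N%:R * gam) by rewrite powR_gt0.
have z0 := normc_ge0 (urn_char n theta s).
move: (normc _) z0 => z z0 h.
have {h4}h : k1 * n%:R `^ (N%:R * gam) * z <= (C * nu `^ gam) ^+ N.
  rewrite -(ler_pM2r r0); apply: le_trans h; rewrite mulrAC.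
  by rewrite ler_wpM2r.
rewrite powR_quot ?(ltW nu0) //.
have -> : nu `^ (N%:R * gam) = (nu `^ gam) ^+ N.
  by rewrite mulrC powRrM powR_mulrn // ltW.
rewrite mulrA ler_pdivlMr // mulrAC ler_pdivlMr //.
by move: h; rewrite exprMn; apply: le_trans; rewrite le_eqVlt; apply/orP; left;
  apply/eqP; ring.
Qed.

(** Waiting for [k] draws before using [urn_char_bound] makes the exponent
    [(1 + k * (a + b)) / (2 * m)] as large as desired. *)
Lemma urn_char_decay e (rho : R) : elementary e -> 0 < rho ->
  exists2 C : R, 0 < C & forall t : R, 1 <= `|t| ->
  \forall n \near \oo,
     normc (urn_char n (t / n%:R `^ sigma) e) <= C / `|t| `^ rho.
Proof.
move=> ee rho0; pose k := (Num.truncn (2 * m_ * rho)).+1.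
have kr : 2 * m_ * rho <= k%:R by apply/ltW/truncnS_gt.
pose N := (1 + k * (a + b))%N.
have N0 : (0 < N)%N by rewrite /N add1n.
have [C [nu0 [C0 nu00 hC]]] := @urn_char_bound N N0.
have Ng : 0 <= N%:R * gam by rewrite mulr_ge0 // ltW.
exists (C * 2 `^ (N%:R * gam)) => [|t t1]; first by rewrite mulr_gt0 ?powR_gt0.
have t0 : 0 < `|t| by apply: lt_le_trans t1.
have tp : 0 < `|t| `^ sigma^-1 by rewrite powR_gt0.
near=> n.
have nk : (k.*2 < n)%N by near: n; exists (k.*2.+1).
have n0 : (0 < n)%N by apply: leq_ltn_trans nk.
have n0R : 0 < n%:R :> R by rewrite ltr0n.
have kn : (k <= n)%N by apply: ltnW; apply: leq_ltn_trans nk; rewrite -addnn leq_addr.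
have nk0 : (0 < n - k)%N.
  by rewrite subn_gt0; apply: leq_ltn_trans nk; rewrite -addnn leq_addr.
rewrite -{1}(subnKC kn); apply: urn_char_iter_le => s' ss'.
have sN : urn_size s' = N.
  by rewrite ss' /N; case: ee => ->; rewrite /urn_size /= ?addn0 ?add0n.
have nup : 0 < n%:R `^ sigma :> R by rewrite powR_gt0.
apply: (le_trans (hC _ (n%:R / `|t| `^ sigma^-1) (n - k)%N s' sN _ _ nk0)).
- rewrite powR_quot // -powRrM mulVf ?gt_eqF // powRr1 // normrM normfV.
  by rewrite (gtr0_norm nup); field; rewrite !gt_eqF.
- rewrite ler_pdivlMr //; near: n.
  apply: filterS (powR_natr_large (nu0 * `|t| `^ sigma^-1) ltr01) => n.
  by rewrite powRr1.
rewrite -mulrA ler_wpM2l ?(ltW C0) //.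
have n20 : 0 < (n - k)%:R :> R by rewrite ltr0n.
apply: (@le_trans _ _ ((2 / `|t| `^ sigma^-1) `^ (N%:R * gam))).
  rewrite ge0_ler_powR ?nnegrE ?divr_ge0 ?powR_ge0 //.
  rewrite mulrAC ler_pM2r ?invr_gt0 // ler_pdivrMr // -natrM ler_nat.
  by rewrite mulnBr leq_subRL ?leq_mul // !mul2n -(addnn n) leq_add2r ltnW.
rewrite powR_quot // ler_wpM2l ?powR_ge0 // lef_pV2 ?posrE ?powR_gt0 //.
rewrite -powRrM ler_powR //.
have gE : gam = S_^-1 / 2 by rewrite -gam2; move: gam => x; lra.
have NE : k%:R * S_ <= N%:R by rewrite /N natrD natrM lerDr.
have S1 : 1 <= S_ by rewrite ler1n.
have -> : sigma^-1 * (N%:R * gam) = N%:R / (2 * m_).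
  have := lt0r_neq0 S0; have := lt0r_neq0 m0; rewrite gE.
  by move: (urn_S R a b) (urn_m R a c) => x y y0 x0; field; rewrite x0 y0.
rewrite ler_pdivlMr ?mulr_gt0 // mulrC; apply: (le_trans kr).
by apply: le_trans NE; rewrite ler_peMr.
Unshelve. all: by end_near. Qed.

End urn_decay.

(** * From the random process to the transition operator *)

Section urn_law.
Variable R : realType.
Variables a b c d : nat.
Variables (disp : measure_display) (T : measurableType disp).
Variables (P : probability T R) (D : nat -> {RV P >-> bool}).
Variable s0 : nat * nat.
Hypothesis drawsD : urn_draws a b c d s0 D.
Implicit Types (e : nat -> bool) (n k l : nat) (f : nat * nat -> R).

Local Notation past n e := [set w | forall k, (k < n)%N -> D k w = e k].
Local Notation U := (urn_process a b c d s0 D).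
Local Notation state e n := (urn_state a b c d s0 e n).

Lemma measurable_draw k x : measurable [set w | D k w = x].
Proof.
rewrite (_ : [set w | _] = D k @^-1` [set x]) //.
exact: measurable_funPTI.
Qed.

Definition set_draw e k x : nat -> bool := fun j => if j == k then x else e j.

Lemma past_set_draw e k x :
  past k.+1 (set_draw e k x) = past k e `&` [set w | D k w = x].
Proof.
apply/seteqP; split => w /=.
  move=> h; split; last by have := h k (ltnSn k); rewrite /set_draw eqxx.
  move=> j jk; have := h j (ltnW jk); rewrite /set_draw.
  by rewrite (ltn_eqF jk).
move=> [h1 h2] j; rewrite ltnS leq_eqVlt /set_draw => /predU1P[->|jk].
  by rewrite eqxx.
by rewrite (ltn_eqF jk) h1.
Qed.

Lemma measurable_past n e : measurable (past n e).
Proof.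
elim: n => [|n IHn].
  rewrite (_ : [set w | _] = setT); first exact: measurableT.
  by apply/seteqP; split.
rewrite (_ : past n.+1 e = past n.+1 (set_draw e n (e n))).
  by rewrite past_set_draw; apply: measurableI => //; exact: measurable_draw.
by apply/seteqP; split => w /= h j jn; rewrite h // /set_draw; case: eqP => [->|].
Qed.

Lemma urn_state_ext e e' n : (forall k, (k < n)%N -> e k = e' k) ->
  state e n = state e' n.
Proof.
elim: n => //= n IHn ee'; rewrite IHn ?ee' // => k kn.
by rewrite ee' // ltnW.
Qed.

Lemma measurable_process f n : measurable_fun setT (fun w => f (U n w)).
Proof.
elim: n f => [|n IHn] f; first exact: (measurable_cst (f s0)).
rewrite (_ : (fun w => _) = (fun w => if D n w
    then f (red a b (U n w)) else f (black c d (U n w)))).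
  apply: measurable_fun_ifT; first exact: measurable_funPT.
    exact: (IHn (f \o red a b)).
  exact: (IHn (f \o black c d)).
by apply/funext => w; rewrite /urn_process /=; case: (D n w).
Qed.

(** By induction on [l], splitting the event according to the colour of the next
    ball. *)
Lemma urn_markov f l k e :
  (\int[P]_(w in past k e) (f (U (k + l)%N w))%:E
   = (urn_iter a b c d l f (state e k))%:E * P (past k e))%E.
Proof.
elim: l k e => [|l IHl] k e.
  rewrite addn0 -integral_cst; last exact: measurable_past.
  apply: eq_integral => w; rewrite inE /= => pw.
  by rewrite /urn_process (urn_state_ext pw).
have split_past : past k e =
    past k.+1 (set_draw e k true) `|` past k.+1 (set_draw e k false).
  rewrite !past_set_draw -setIUr; apply/esym/setIidPl => w _ /=.
  by case: (D k w); [left|right].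
have disj : [disjoint past k.+1 (set_draw e k true) & past k.+1 (set_draw e k false)].
  rewrite !past_set_draw; apply/disj_setPS => w /= [[_ h1] [_ h2]].
  by rewrite h1 in h2.
rewrite {1}split_past integral_setU; last 4 first.
- exact: measurable_past.
- exact: measurable_past.
- apply/measurable_EFinP; apply: measurable_funS (measurable_process f _) => //.
- exact: disj.
rewrite addnS -addSn !IHl /=.
have set_drawE x : state (set_draw e k x) k = state e k.
  by apply: urn_state_ext => j jk; rewrite /set_draw (ltn_eqF jk).
rewrite !set_drawE /set_draw !eqxx.
have Pr : P (past k.+1 (set_draw e k true))
    = ((red_fraction R (state e k))%:E * P (past k e))%E.
  by rewrite past_set_draw; exact: drawsD.
have Pb : P (past k.+1 (set_draw e k false))
    = ((1 - red_fraction R (state e k))%:E * P (past k e))%E.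
  have : P (past k e) = (P (past k.+1 (set_draw e k true))
      + P (past k.+1 (set_draw e k false)))%E.
    rewrite {1}split_past measureU //.
    - exact: measurable_past.
    - exact: measurable_past.
    - by move/disj_set2P: disj.
  rewrite Pr; have : P (past k e) \is a fin_num.
    by apply: fin_num_measure; exact: measurable_past.
  have : P (past k.+1 (set_draw e k false)) \is a fin_num.
    by apply: fin_num_measure; exact: measurable_past.
  case: (P (past k e)) => // p; case: (P (past k.+1 _)) => // p' _ _.
  rewrite -EFinM -EFinD => -[E]; rewrite -EFinM; congr EFin.
  by rewrite mulrBl mul1r {1}E addrC addKr.
have : P (past k e) \is a fin_num.
  by apply: fin_num_measure; exact: measurable_past.
rewrite Pr Pb; case: (P (past k e)) => // p _.
by rewrite -!EFinM -EFinD; congr EFin; rewrite /urn_op /red /black; ring.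
Qed.

Lemma urn_expectation f n :
  (\int[P]_w (f (U n w))%:E = (urn_iter a b c d n f s0)%:E)%E.
Proof.
have pT : past 0 (fun=> true) = setT by apply/seteqP; split.
have := urn_markov f n 0 (fun=> true).
by rewrite pT add0n probability_setT mule1.
Qed.

End urn_law.

Section urn_limit_law.
Variable R : realType.
Variables a b c d : nat.
Hypothesis balanced : (a + b = c + d)%N.
Hypothesis nontriangular : (b * c <> 0)%N.
Hypothesis large : urn_S R a b / 2 < urn_m R a c < urn_S R a b.
Variables (disp : measure_display) (T : measurableType disp).
Variables (P : probability T R) (D : nat -> {RV P >-> bool}).
Variable e : nat * nat.
Hypothesis ee : elementary e.
Hypothesis drawsD : urn_draws a b c d e D.
Variable W : {RV P >-> R}.
Hypothesis limW : urn_limit a b c d e D W.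

Local Notation S_ := (urn_S R a b).
Local Notation m_ := (urn_m R a c).
Local Notation sigma := (m_ / S_).
Local Notation u2 := (@urn_u2 R a b c).
Local Notation normc := ComplexField.Normc.normc.

Lemma urn_limit_test (h : R -> R) (M : R) : continuous h ->
  (forall x, `|h x| <= M) ->
  urn_iter a b c d n (fun s => h ((n%:R `^ sigma)^-1 * u2 s)) e
    @[n --> \oo] --> fine (\int[P]_w (h (W w))%:E)%E.
Proof.
move=> hc hM.
have mh : measurable_fun setT h by apply: continuous_measurable_fun.
have [|||||iW _] := @dominated_convergence _ _ _ P setT measurableT
  (fun n w => (h ((n%:R `^ sigma)^-1 * u2 (urn_process a b c d e D n w)))%:E)
  (fun w => (h (W w))%:E) (fun=> M%:E).
- move=> n; apply/measurable_EFinP.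
  exact: (@measurable_process R a b c d disp T P D e
    (fun s => h ((n%:R `^ sigma)^-1 * u2 s)) n).
- by apply/measurable_EFinP; apply: measurableT_comp.
- apply: filterS limW => w lw _; apply: cvg_EFin; first exact: nearW.
  by apply: (cvg_comp _ _ lw); exact: hc.
- exact: finite_measure_integrable_cst.
- by apply: nearW => w n _; rewrite lee_fin.
under eq_fun do rewrite (urn_expectation drawsD (fun s => h (_ * u2 s))).
have /fineK {1}<- := integrable_fin_num measurableT iW.
by move=> /fine_cvg.
Qed.

(** The expectation of a bump around [x] is bounded below along the urn, hence
    positive at the limit. *)
Lemma urn_limit_support : measure_support (distribution P W) = setT.
Proof.
apply/seteqP; split=> // x _ V oV Vx.
have [eps eps0 ballV] : exists2 eps : R, 0 < eps & forall y, `|y - x| < eps -> V y.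
  have /nbhs_ballP[eps /= eps0 h] : nbhs x V by exact: open_nbhs_nbhs.
  by exists eps => // y yx; apply: h; rewrite /ball /= distrC.
pose h (y : R) := Num.max 0 (eps - `|y - x|).
have hc : continuous h.
  move=> y; apply: (@continuous_max R R (cst 0) (fun z => eps - `|z - x|)).
    exact: cvg_cst.
  apply: cvgB; first exact: cvg_cst.
  by apply: cvg_norm; apply: cvgB => //; exact: cvg_cst.
have h0 y : 0 <= h y by rewrite le_max lexx.
have hM y : `|h y| <= eps.
  by rewrite ger0_norm // /h ge_max (ltW eps0) gerBl normr_ge0.
have := urn_limit_test hc hM.
have e20 : 0 < eps / 2 by rewrite divr_gt0.
have [p [n1 [p0 hp]]] := urn_near balanced nontriangular large x ee e20.
move=> lim; have mV : measurable V by exact: open_measurable.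
have lb : eps / 2 * p <= fine (\int[P]_w (h (W w))%:E)%E.
  apply: cvgr_to_ge lim _; exists n1 => // n /= n1n.
  apply: (@le_trans _ _ (eps / 2 *
    urn_iter a b c d n (near_ind a b c (n%:R `^ sigma) x (eps / 2)) e)).
    by rewrite ler_wpM2l ?(ltW e20) // hp.
  rewrite -[leLHS]addr0 -[X in _ + X](mul0r (urn_iter a b c d n (fun=> 0) e)).
  rewrite -urn_iterDM; apply: urn_iter_le => // s _; rewrite mul0r addr0.
  rewrite /near_ind [_^-1 * _]mulrC.
  case: (lerP `|u2 s / n%:R `^ sigma - x| (eps / 2)) => [hs|_].
    by rewrite mulr1 le_max; apply/orP; right; move: hs; lra.
  by rewrite mulr0.
have mh : measurable_fun setT (fun w => (h (W w))%:E).
  apply/measurable_EFinP; apply: measurableT_comp => //.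
  exact: continuous_measurable_fun.
have ub : (\int[P]_w (h (W w))%:E <= eps%:E * distribution P W V)%E.
  have mWV : measurable (W @^-1` V) by exact: measurable_funPTI.
  rewrite /distribution /pushforward -(integral_cst P mWV).
  have -> : (\int[P]_w (h (W w))%:E = \int[P]_(w in W @^-1` V) (h (W w))%:E)%E.
    rewrite [RHS]integral_mkcond; apply: eq_integral => w _; rewrite patchE.
    case: ifPn => // /negP nV; congr EFin; apply/max_idPl.
    rewrite subr_le0 leNgt; apply/negP => /ballV Vw.
    by apply: nV; rewrite inE.
  apply: ge0_le_integral => //.
  - by move=> w _; rewrite lee_fin.
  - exact: measurable_funTS.
  - by move=> w _; rewrite lee_fin; apply: le_trans (hM (W w)); exact: ler_norm.
have fV : distribution P W V \is a fin_num by exact: fin_num_measure.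
rewrite -(fineK fV) lte_fin -(pmulr_rgt0 _ eps0).
rewrite -(fineK fV) -EFinM in ub.
apply: (@lt_le_trans _ _ (eps / 2 * p)); first by rewrite mulr_gt0.
apply: (le_trans lb); rewrite -lee_fin fineK //.
rewrite ge0_fin_numE; first by apply: le_lt_trans ub _; rewrite ltry.
by apply: integral_ge0 => w _; rewrite lee_fin.
Qed.

Lemma urn_limit_char_le (t B : R) : 0 <= B ->
  (\forall n \near \oo,
    normc (urn_char a b c d n (t / n%:R `^ sigma) e) <= B) ->
  normc (char_fun W t) <= B.
Proof.
move=> B0 hB.
have ct (f : R -> R) : continuous f -> continuous (fun y => f (t * y)).
  move=> cf y; apply: (@continuous_comp _ _ _ (fun y => t * y) f).
    exact: mulrl_continuous.
  exact: cf.
have hc := urn_limit_test (ct _ (@continuous_cos R)) (fun y => cos_max (t * y)).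
have hs := urn_limit_test (ct _ (@continuous_sin R)) (fun y => sin_max (t * y)).
rewrite /char_fun /cexpectation unlock /=.
set x := fine _ in hc *; set y := fine _ in hs *.
have B2 : x ^+ 2 + y ^+ 2 <= B ^+ 2.
  pose X n : R := urn_iter a b c d n (fun s => cos (t * ((n%:R `^ sigma)^-1 * u2 s))) e.
  pose Y n : R := urn_iter a b c d n (fun s => sin (t * ((n%:R `^ sigma)^-1 * u2 s))) e.
  have lim : X n * X n + Y n * Y n @[n --> \oo] --> x * x + y * y.
    by apply: cvgD; apply: cvgM.
  rewrite -!expr2 in lim; apply: (cvgr_to_le lim).
  apply: filterS hB => n h.
  have EX : X n = urn_iter a b c d n (fun s => cos (t / n%:R `^ sigma * u2 s)) e.
    by apply: urn_iter_ext => s; rewrite mulrA.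
  have EY : Y n = urn_iter a b c d n (fun s => sin (t / n%:R `^ sigma * u2 s)) e.
    by apply: urn_iter_ext => s; rewrite mulrA.
  rewrite -?expr2 EX EY -[leLHS]sqr_sqrtr ?addr_ge0 ?sqr_ge0 //.
  by rewrite lerXn2r ?nnegrE ?sqrtr_ge0.
rewrite -(ger0_norm B0) -sqrtr_sqr ler_sqrt //.
by rewrite sqr_ge0.
Qed.

End urn_limit_law.

(** * Fourier inversion *)

Section laplace.
Variable R : realType.
Notation mu := (@lebesgue_measure R).
Implicit Types (eps x y t : R).

Let damp_cvg0 eps (M : R) (f : R -> R) : 0 < eps -> (forall t, `|f t| <= M) ->
  expR (- (eps * t)) * f t @[t --> +oo] --> (0 : R).
Proof.
move=> eps0 fM.
have h : expR (- (eps * t)) @[t --> +oo] --> (0 : R).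
  apply: (cvg_comp (fun t => eps * t) (fun t => expR (- t))); last exact: cvgr_expR.
  by apply: gt0_cvgMry.
apply/norm_cvg0P.
apply: (@squeeze_cvgr _ _ _ _ (cst 0) (fun t => expR (- (eps * t)) * M)).
- apply: nearW => t; rewrite normr_ge0 /= normrM gtr0_norm ?expR_gt0 //.
  by rewrite ler_wpM2l ?expR_ge0.
- exact: cvg_cst.
- by rewrite -[X in _ --> X](mul0r M); apply: cvgMr_tmp.
Qed.

(** The condition on [p] and [q] keeps the integrand nonnegative, so that its
    integral is the increment of the primitive. *)
Let laplace_ge0 eps y (p q : R) : 0 < eps -> `|q| <= p ->
  (\int[mu]_(t in `[0%R, +oo[) (expR (- (eps * t)) * (p + q * cos (t * y)))%:E
   = (p / eps + q * (eps / (eps ^+ 2 + y ^+ 2)))%:E)%E.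
Proof.
move=> eps0 pq.
have den0 : 0 < eps ^+ 2 + y ^+ 2 by rewrite ltr_pwDl ?exprn_gt0 ?sqr_ge0.
(* [expR (- (eps * t)) * G t] is a primitive of the integrand. *)
pose G t := - (p / eps) + (q * (y * sin (t * y)) - q * (eps * cos (t * y)))
   / (eps ^+ 2 + y ^+ 2).
pose F t := expR (- (eps * t)) * G t.
have dmul t z : is_derive t (1 : R) (fun s => s * z) z.
  have := is_deriveM (is_derive_id t (1 : R)) (is_derive_cst z t (1 : R)).
  by move/is_derive_eq; apply; rewrite scaler0 add0r /GRing.scale /= mulr1.
have dsin t : is_derive t (1 : R) (fun s => sin (s * y)) (cos (t * y) * y).
  exact: (@is_derive1_comp _ sin (fun s => s * y)).
have dcos t : is_derive t (1 : R) (fun s => cos (s * y)) (- sin (t * y) * y).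
  exact: (@is_derive1_comp _ cos (fun s => s * y)).
have dexp t : is_derive t (1 : R) (fun s => expR (- (eps * s)))
    (expR (- (eps * t)) * - eps).
  apply: (@is_derive1_comp _ expR (fun s => - (eps * s))).
  have := is_deriveN (dmul t eps).
  rewrite (_ : - (fun s : R => s * eps) = (fun s => - (eps * s))) //.
  by apply/funext => s; rewrite [eps * s]mulrC.
have dG t : is_derive t (1 : R) G ((q * (y * (cos (t * y) * y))
    - q * (eps * (- sin (t * y) * y))) / (eps ^+ 2 + y ^+ 2)).
  have h1 := is_deriveZ q (is_deriveZ y (dsin t)).
  have h2 := is_deriveZ q (is_deriveZ eps (dcos t)).
  have := is_deriveD (is_derive_cst (- (p / eps)) t (1 : R))
    (is_deriveZ (eps ^+ 2 + y ^+ 2)^-1 (is_deriveB h1 h2)).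
  rewrite (_ : (_ + _) = G); last first.
    by apply/funext => s; rewrite /G; congr (_ + _); exact: mulrC.
  by move/is_derive_eq; apply; rewrite add0r; exact: mulrC.
have dF t : is_derive t (1 : R) F (expR (- (eps * t)) * (p + q * cos (t * y))).
  have := is_deriveM (dexp t) (dG t); move/is_derive_eq; apply.
  by rewrite /GRing.scale /= /G; field; rewrite !gt_eqF.
rewrite (@ge0_continuous_FTC2y _ _ F 0 0).
- rewrite /F /G mulr0 oppr0 expR0 mul0r sin0 cos0 mul1r.
  by rewrite -EFinB; congr EFin; field; rewrite !gt_eqF.
- move=> t _; rewrite mulr_ge0 ?expR_ge0 //.
  have : `|q * cos (t * y)| <= p.
    by rewrite normrM; apply: le_trans pq; rewrite ler_piMr // cos_max.
  by rewrite ler_norml => /andP[]; lra.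
- have dcont (f : R -> R) t df : is_derive t (1 : R) f df -> {for t, continuous f}.
    by move=> [h _]; exact/differentiable_continuous/derivable1_diffP.
  apply: continuous_subspaceT => t; apply: cvgM; first exact: dcont (dexp t).
  apply: cvgD; first exact: cvg_cst.
  by apply: cvgMl_tmp; exact: dcont (dcos t).
- apply: (@damp_cvg0 _ (p / eps + `|q| * (`|y| + eps) / (eps ^+ 2 + y ^+ 2))) => // t.
  rewrite /G; apply: (le_trans (ler_normD _ _)); rewrite normrN; apply: lerD.
    by rewrite ger0_norm // divr_ge0 ?(ltW eps0) // (le_trans _ pq).
  rewrite normrM (gtr0_norm (x := _^-1)) ?invr_gt0 // ler_pM2r ?invr_gt0 //.
  rewrite -mulrBr normrM ler_wpM2l //; apply: (le_trans (ler_normB _ _)).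
  rewrite !normrM (gtr0_norm eps0); apply: lerD.
    by rewrite ler_piMr // sin_max.
  by rewrite ler_piMr ?(ltW eps0) // cos_max.
- by move=> t _; have [] := dF t.
- have [h _] := dF 0; apply: cvg_at_right_filter.
  exact/differentiable_continuous/derivable1_diffP.
- by move=> t _; rewrite derive1E; have [_ ->] := dF t.
Qed.

Let continuous_damp eps y : continuous (fun t => expR (- (eps * t)) * cos (t * y)).
Proof.
move=> t; apply: cvgM.
  apply: (@continuous_comp _ _ _ (fun s => - (eps * s)) expR);
    last exact: continuous_expR.
  by apply: cvgN; apply: cvgMl_tmp; exact: cvg_id.
apply: (cvg_comp (fun s => s * y) cos); last exact: continuous_cos.
by apply: cvgMr_tmp; exact: cvg_id.
Qed.

Lemma integrable_expR eps : 0 < eps ->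
  mu.-integrable `[0, +oo[ (EFin \o (fun t => expR (- (eps * t)))).
Proof.
move=> eps0; apply/integrableP; split.
  apply/measurable_EFinP; apply: measurable_funTS.
  apply: continuous_measurable_fun; have := @continuous_damp eps 0.
  rewrite (_ : (fun t => _) = (fun t => expR (- (eps * t)))) //.
  by apply/funext => t; rewrite mulr0 cos0 mulr1.
have := @laplace_ge0 eps 0 1 0 eps0; rewrite normr0 ler01 => /(_ isT) E.
rewrite (_ : (\int[mu]_(x in _) _)%E = (1 / eps)%:E) ?ltry //.
rewrite [in RHS](_ : 1 / eps = 1 / eps + 0 * (eps / (eps ^+ 2 + 0 ^+ 2)));
  last by rewrite mul0r addr0.
rewrite -E; apply: eq_integral => t _ /=.
by rewrite gtr0_norm ?expR_gt0 // mul0r addr0 mulr1.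
Qed.

Lemma integrable_damped_cos eps y : 0 < eps ->
  mu.-integrable `[0, +oo[ (EFin \o (fun t => expR (- (eps * t)) * cos (t * y))).
Proof.
move=> eps0; apply: le_integrable (integrable_expR eps0) => //.
  apply/measurable_EFinP; apply: measurable_funTS.
  exact: continuous_measurable_fun.
by move=> t _ /=; rewrite lee_fin normrM ler_piMr // cos_max.
Qed.

Lemma integral_damped_cos eps y : 0 < eps ->
  (\int[mu]_(t in `[0%R, +oo[) (expR (- (eps * t)) * cos (t * y))%:E
   = (eps / (eps ^+ 2 + y ^+ 2))%:E)%E.
Proof.
move=> eps0.
have := @laplace_ge0 eps y 1 1 eps0; rewrite normr1 lexx => /(_ isT).
have := @laplace_ge0 eps y 1 0 eps0; rewrite normr0 ler01 => /(_ isT).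
have E : (\int[mu]_(t in `[0%R, +oo[) (expR (- (eps * t)) * (1 + 1 * cos (t * y)))%:E
   = \int[mu]_(t in `[0%R, +oo[) (expR (- (eps * t)) * (1 + 0 * cos (t * y)))%:E
   + \int[mu]_(t in `[0%R, +oo[) (expR (- (eps * t)) * cos (t * y))%:E)%E.
  rewrite -integralD_EFin //=; last exact: integrable_damped_cos.
    by apply: eq_integral => t _; rewrite -EFinD; congr EFin; ring.
  apply: eq_integrable (integrable_expR eps0) => // t _ /=.
  by rewrite mul0r addr0 mulr1.
rewrite E => ->; rewrite !mul1r mul0r addr0.
have := integrable_fin_num _ (integrable_damped_cos y eps0).
move=> /(_ (measurable_itv _)); case: (integral _ _ _) => // r _.
by rewrite -EFinD => -[] /addrI ->.
Qed.

End laplace.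

Section density_measure.
Variable R : realType.
Variable f : R -> R.
Hypothesis f0 : forall x, 0 <= f x.
Hypothesis mf : measurable_fun setT f.

(** The proofs [f0] and [mf] are arguments for the measure structure to be found
    from the term alone. *)
Definition density_measure (f0 : forall x, 0 <= f x) (mf : measurable_fun setT f)
  (A : set R) : \bar R :=
  (\int[@lebesgue_measure R]_(x in A) (f x)%:E)%E.

Local Notation nu := (density_measure f0 mf).

Let nu0 : nu set0 = 0%E. Proof. by rewrite /density_measure integral_set0. Qed.

Let nu_ge0 A : (0 <= nu A)%E.
Proof. by apply: integral_ge0 => x _; rewrite lee_fin. Qed.

Let nu_sigma_additive : semi_sigma_additive nu.
Proof.
move=> /= F mF tF mUF; rewrite /density_measure; apply: cvg_toP.
  apply: ereal_nondecreasing_is_cvgn => m n mn.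
  apply: lee_sum_nneg_natr => // k _ _; exact: nu_ge0.
rewrite ge0_integral_bigcup //=.
- by apply/measurable_EFinP; apply: measurable_funTS.
- by move=> x _; rewrite lee_fin.
Qed.

HB.instance Definition _ := isMeasure.Build _ _ _ nu nu0 nu_ge0 nu_sigma_additive.

End density_measure.

Section inversion.
Variable R : realType.
Variables (disp : measure_display) (T : measurableType disp).
Variables (P : probability T R) (X : {RV P >-> R}).
Local Notation mu := (@lebesgue_measure R).
Local Notation normc := ComplexField.Normc.normc.
Implicit Types (x y t u v : R) (w : T).

Let bounded_integrable (h : T -> R) (M : R) : measurable_fun setT h ->
  (forall w, `|h w| <= M) -> P.-integrable setT (EFin \o h).
Proof.
move=> mh hM; have iM : P.-integrable setT (EFin \o cst M).
  exact: finite_measure_integrable_cst.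
apply: (le_integrable _ _ _ iM) => //; first exact/measurable_EFinP.
by move=> w _ /=; rewrite lee_fin (le_trans (hM w)) // ler_norm.
Qed.

Lemma fubini_bounded (A : set R) (f : R -> T -> R) (g : R -> R) : measurable A ->
  measurable_fun setT (fun z : R * T => f z.1 z.2) ->
  mu.-integrable A (EFin \o g) -> (forall x w, A x -> `|f x w| <= g x) ->
  (\int[mu]_(x in A) \int[P]_w (f x w)%:E
   = \int[P]_w \int[mu]_(x in A) (f x w)%:E)%E.
Proof.
move=> mA mf ig fg.
pose h (z : R * T) : \bar R := (f z.1 z.2 * \1_A z.1)%:E.
have mh : measurable_fun setT h.
  apply/measurable_EFinP/measurable_funM => //.
  apply: measurableT_comp => //; exact: measurable_fun_indic.
have ih : (mu \x P)%E.-integrable setT h.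
  apply/integrable12ltyP => //.
  have /integrableP[_] := ig; apply: le_lt_trans.
  rewrite [leRHS]integral_mkcond; apply: ge0_le_integral => //.
  - by move=> x _; exact: integral_ge0.
  - apply: (measurable_fun_fubini_tonelli_F (m2 := P) (fun z => `|h z|%E)) => //.
    exact: measurableT_comp.
  - apply/(measurable_restrictT _ mA); apply: measurableT_comp => //.
    exact: measurable_int ig.
  - move=> x _; rewrite patchE; case: ifPn => xA; last first.
      rewrite integral0_eq // => w _.
      by rewrite /h /= indicE (negbTE xA) mulr0 normr0.
    apply: (@le_trans _ _ (\int[P]_w (cst (`|g x|)%:E w))%E); last first.
      rewrite (_ : (\int[P]_w _)%E = (`|g x|%:E * P setT)%E); last exact: integral_cst.
      by rewrite probability_setT mule1.
    apply: ge0_le_integral => //.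
    + apply: measurableT_comp => //; apply: measurableT_comp mh _ => //.
    + move=> w _; rewrite /h /= indicE xA mulr1 lee_fin.
      by apply: le_trans (ler_norm _); apply: fg; rewrite inE in xA.
have F := @Fubini _ _ _ _ R mu P h ih.
transitivity (\int[mu]_x \int[P]_w h (x, w))%E.
  rewrite integral_mkcond; apply: eq_integral => x _; rewrite patchE.
  case: ifPn => xA; rewrite /h /= indicE.
    by rewrite xA; apply: eq_integral => w _; rewrite mulr1.
  by rewrite (negbTE xA) integral0_eq // => w _; rewrite mulr0.
rewrite F; apply: eq_integral => w _; rewrite [RHS]integral_mkcond.
apply: eq_integral => x _; rewrite patchE /h /= indicE.
by case: ifPn => xA; rewrite ?xA ?(negbTE xA) ?mulr1 ?mulr0.
Qed.

Variable K : R.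
Hypothesis hK : forall t, normc (char_fun X t) <= K * (oneDsqr t)^-1.

(** The integrand [exp (- i t x) * char_fun X t] of the inversion formula, in
    real form: its real part is even and its imaginary part odd in [t]. *)
Let psi x t := \int[P]_w cos (t * (X w - x)).

Let mcos y x : measurable_fun setT (fun w => cos (y * (X w - x))).
Proof.
apply: measurableT_comp; first exact: (continuous_measurable_fun (@continuous_cos R)).
by apply: measurable_funM => //; apply: measurable_funB.
Qed.

Let icos y x : P.-integrable setT (fun w => (cos (y * (X w - x)))%:E).
Proof. by apply: (@bounded_integrable _ 1) => // w; exact: cos_max. Qed.

Let msin y x : measurable_fun setT (fun w => sin (y * (X w - x))).
Proof.
apply: measurableT_comp; first exact: (continuous_measurable_fun (@continuous_sin R)).
by apply: measurable_funM => //; apply: measurable_funB.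
Qed.

Let isin y x : P.-integrable setT (fun w => (sin (y * (X w - x)))%:E).
Proof. by apply: (@bounded_integrable _ 1) => // w; exact: sin_max. Qed.

Let Cphi t := \int[P]_w cos (t * (X w - 0)).
Let Dphi t := \int[P]_w sin (t * (X w - 0)).

Let psiE x t : psi x t = cos (t * x) * Cphi t + sin (t * x) * Dphi t.
Proof.
rewrite /psi /Cphi /Dphi -!RintegralZl //; try exact: icos; try exact: isin.
rewrite -RintegralD //=.
- by apply: eq_Rintegral => w _; rewrite mulrBr subr0 cosB; ring.
- by apply: (integrableZl _ _ (icos t 0)).
- by apply: (integrableZl _ _ (isin t 0)).
Qed.

Let psi_le x t : `|psi x t| <= K * (oneDsqr t)^-1.
Proof.
have E : char_fun X t = Complex (Cphi t) (Dphi t).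
  rewrite /char_fun /cexpectation unlock /Cphi /Dphi /Rintegral.
  by congr Complex; congr fine; apply: eq_integral => w _; rewrite subr0.
apply: le_trans (hK t); rewrite psiE E /=; move: (Cphi t) (Dphi t) => c s.
rewrite -sqrtr_sqr ler_sqrt ?addr_ge0 ?sqr_ge0 //.
have := cos2Dsin2 (t * x); move: (cos _) (sin _) => a b ab.
have := sqr_ge0 (a * s - b * c); nra.
Qed.

Let continuous_psi x : continuous (psi x).
Proof.
move=> t; have tI : t \in `]t - 1, t + 1[.
  by rewrite in_itv /=; apply/andP; split; lra.
have h := @continuity_under_integral R _ T P (fun s w => cos (s * (X w - x))) setT
  measurableT (t - 1) (t + 1) _ _ (cst 1) _ _.
apply: (h _ _ _ _ t); last by rewrite inE.
- by move=> s _; exact: icos.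
- apply: nearW => w _ s _.
  apply: (cvg_comp (fun s => s * (X w - x)) cos); last exact: continuous_cos.
  by apply: cvgMr_tmp; exact: cvg_id.
- exact: finite_measure_integrable_cst.
- by move=> s _; apply: nearW => w _; exact: cos_max.
Qed.

Let igK : mu.-integrable `[0, +oo[ (EFin \o (fun t => K * (oneDsqr t)^-1)).
Proof.
apply: (@eq_integrable _ _ _ mu _ _ (fun t => K%:E * ((oneDsqr t)^-1)%:E)%E) => //.
apply: integrableZl => //; apply/integrableP; split.
  apply/measurable_EFinP; apply: measurable_funTS.
  exact: (continuous_measurable_fun (@continuous_oneDsqrV R)).
rewrite (_ : (\int[mu]_(x in _) _)%E = (pi / 2)%:E) ?ltry //.
rewrite -integral0y_oneDsqr; apply: eq_integral => t _ /=.
by rewrite ger0_norm // invr_ge0.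
Qed.

(** The Cauchy kernel, whose Fourier transform is [exp (- eps |t|)]. *)
Let cauchy eps y : R := pi^-1 * (eps / (eps ^+ 2 + y ^+ 2)).

Let cauchy_ge0 eps y : 0 < eps -> 0 <= cauchy eps y.
Proof.
move=> eps0; rewrite mulr_ge0 ?invr_ge0 ?pi_ge0 // divr_ge0 ?(ltW eps0) //.
by rewrite addr_ge0 ?sqr_ge0.
Qed.

Let cauchy_le eps y : 0 < eps -> `|cauchy eps y| <= pi^-1 / eps.
Proof.
move=> eps0; rewrite ger0_norm ?cauchy_ge0 // ler_wpM2l ?invr_ge0 ?pi_ge0 //.
rewrite ler_pdivrMr ?ltr_pwDl ?exprn_gt0 ?sqr_ge0 //.
rewrite mulrDr expr2 mulrA mulVf ?gt_eqF // mul1r lerDl.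
by rewrite mulr_ge0 ?sqr_ge0 // invr_ge0 ltW.
Qed.

Let continuous_cauchy eps : 0 < eps -> continuous (cauchy eps).
Proof.
move=> eps0 y; apply: cvgMl_tmp; apply: cvgMl_tmp; apply: cvgV.
  by rewrite gt_eqF // ltr_pwDl ?exprn_gt0 ?sqr_ge0.
by apply: cvgD; [exact: cvg_cst | apply: exprn_continuous].
Qed.

Let mcauchy eps x : 0 < eps -> measurable_fun setT (fun w => cauchy eps (X w - x)).
Proof.
move=> eps0; apply: measurableT_comp.
  by apply: continuous_measurable_fun; exact: continuous_cauchy.
exact: measurable_funB.
Qed.

Let icauchy eps x : 0 < eps ->
  P.-integrable setT (EFin \o (fun w => cauchy eps (X w - x))).
Proof.
move=> eps0; apply: (@bounded_integrable _ (pi^-1 / eps)); first exact: mcauchy.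
by move=> w; exact: cauchy_le.
Qed.

(** The inversion integral with a convergence factor: by Fubini's theorem it is
    the density of the law of [X] convolved with the Cauchy kernel. *)
Let damp eps x : R := pi^-1 * \int[mu]_(t in `[0, +oo[) (expR (- (eps * t)) * psi x t).

Let dampE eps x : 0 < eps -> damp eps x = \int[P]_w cauchy eps (X w - x).
Proof.
move=> eps0; rewrite /cauchy RintegralZl //; last first.
  have := integrableZl measurableT pi (icauchy x eps0).
  apply: eq_integrable => // w _; rewrite /= -EFinM /cauchy mulrA divff ?mul1r //.
  by rewrite gt_eqF // pi_gt0.
congr (_ * _); rewrite /Rintegral; congr fine.
transitivity (\int[mu]_(t in `[0%R, +oo[) \int[P]_w
    (expR (- (eps * t)) * cos (t * (X w - x)))%:E)%E.
  apply: eq_integral => t _; rewrite EFinM fineK; last first.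
    exact: integrable_fin_num (icos t x).
  by rewrite -integralZl.
rewrite (@fubini_bounded _ _ (fun t => expR (- (eps * t)))) //.
- by apply: eq_integral => w _; rewrite integral_damped_cos.
- apply: measurable_funM; apply: measurableT_comp => //.
  + by apply: measurableT_comp => //; apply: measurable_funM.
  + exact: (continuous_measurable_fun (@continuous_cos R)).
  + apply: measurable_funM => //; apply: measurable_funB => //.
    exact: measurableT_comp.
- exact: integrable_expR.
- by move=> t w _; rewrite normrM gtr0_norm ?expR_gt0 // ler_piMr ?expR_ge0 // cos_max.
Qed.

Let continuous_damp eps : 0 < eps -> continuous (damp eps).
Proof.
move=> eps0; rewrite (_ : damp eps = fun x => \int[P]_w cauchy eps (X w - x)).
  move=> x; have xI : x \in `]x - 1, x + 1[.
    by rewrite in_itv /=; apply/andP; split; lra.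
  have h := @continuity_under_integral R _ T P (fun s w => cauchy eps (X w - s)) setT
    measurableT (x - 1) (x + 1) _ _ (cst (pi^-1 / eps)) _ _.
  apply: (h _ _ _ _ x); last by rewrite inE.
  - by move=> s _; exact: icauchy.
  - apply: nearW => w _ s _.
    apply: (cvg_comp (fun s => X w - s) (cauchy eps)); last exact: continuous_cauchy.
    by apply: cvgB; [exact: cvg_cst | exact: cvg_id].
  - exact: finite_measure_integrable_cst.
  - by move=> s _; apply: nearW => w _; exact: cauchy_le.
by apply/funext => x; exact: dampE.
Qed.

Let M : R := pi^-1 * (K * (pi / 2)).

Let RintK : \int[mu]_(t in `[0, +oo[) (K * (oneDsqr t)^-1) = K * (pi / 2).
Proof.
rewrite RintegralZl //; first by rewrite /Rintegral integral0y_oneDsqr.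
apply/integrableP; split.
  apply/measurable_EFinP; apply: measurable_funTS.
  exact: (continuous_measurable_fun (@continuous_oneDsqrV R)).
rewrite (_ : (\int[mu]_(x in _) _)%E = (pi / 2)%:E) ?ltry //.
rewrite -integral0y_oneDsqr; apply: eq_integral => t _ /=.
by rewrite ger0_norm // invr_ge0.
Qed.

Let bound_psi (a : R -> R) x : continuous a -> (forall t, 0 <= t -> `|a t| <= 1) ->
  mu.-integrable `[0, +oo[ (EFin \o (fun t => a t * psi x t)) /\
  `|pi^-1 * \int[mu]_(t in `[0, +oo[) (a t * psi x t)| <= M.
Proof.
move=> ca a1; have le_g t : 0 <= t -> `|a t * psi x t| <= K * (oneDsqr t)^-1.
  move=> t0; apply: le_trans (psi_le x t); rewrite normrM ler_piMl //.
  exact: a1.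
have ia : mu.-integrable `[0, +oo[ (EFin \o (fun t => a t * psi x t)).
  apply: (le_integrable _ _ _ igK) => //.
    apply/measurable_EFinP; apply: measurable_funTS.
    apply: continuous_measurable_fun => t; apply: cvgM; first exact: ca.
    exact: continuous_psi.
  move=> t /=; rewrite in_itv /= andbT => t0; rewrite lee_fin.
  by apply: le_trans (ler_norm _); exact: le_g.
split=> //; rewrite normrM ger0_norm ?invr_ge0 ?pi_ge0 //.
rewrite ler_wpM2l ?invr_ge0 ?pi_ge0 // -RintK.
apply: (le_trans (le_normr_Rintegral _ ia)) => //.
apply: le_Rintegral => //.
- by move/integrable_norm: ia.
- by move=> t /=; rewrite in_itv /= andbT => t0; exact: le_g.
Qed.

Let ipsi x : mu.-integrable `[0, +oo[ (EFin \o psi x).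
Proof.
have [||+ _] := @bound_psi (cst 1) x; first exact: cst_continuous.
  by move=> t _; rewrite normr1.
by apply: eq_integrable => // t _; rewrite /= mul1r.
Qed.

Definition inv_density x : R := pi^-1 * \int[mu]_(t in `[0, +oo[) psi x t.

Let inv_density_le x : `|inv_density x| <= M.
Proof.
have [||_] := @bound_psi (cst 1) x; first exact: cst_continuous.
  by move=> t _; rewrite normr1.
by rewrite /inv_density; under eq_Rintegral do rewrite mul1r.
Qed.

Let expR_le1 eps t : 0 < eps -> 0 <= t -> `|expR (- (eps * t))| <= 1.
Proof.
move=> eps0 t0; rewrite gtr0_norm ?expR_gt0 // -expR0 ler_expR oppr_le0.
by rewrite mulr_ge0 // ltW.
Qed.

Let continuous_expRM eps : continuous (fun t => expR (- (eps * t))).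
Proof.
move=> t; apply: (cvg_comp (fun s => - (eps * s)) expR); last exact: continuous_expR.
by apply: cvgN; apply: cvgMl_tmp; exact: cvg_id.
Qed.

Let damp_le eps x : 0 < eps -> `|damp eps x| <= M.
Proof.
move=> eps0; have [||_] // := @bound_psi (fun t => expR (- (eps * t))) x.
by move=> t; exact: expR_le1.
Qed.

Lemma continuous_inv_density : continuous inv_density.
Proof.
move=> x; apply: cvgMl_tmp; have xI : x \in `]x - 1, x + 1[.
  by rewrite in_itv /=; apply/andP; split; lra.
have h := @continuity_under_integral R _ _ mu (fun s t => psi s t) `[0, +oo[
  (measurable_itv _) (x - 1) (x + 1) _ _ (fun t => K * (oneDsqr t)^-1) _ _.
apply: (h _ _ _ _ x); last by rewrite inE.
- by move=> s _; exact: ipsi.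
- apply: nearW => t _ s _; rewrite (_ : psi^~ t =
    (fun s => cos (t * s) * Cphi t + sin (t * s) * Dphi t)); last first.
    by apply/funext => z; rewrite psiE.
  apply: cvgD; apply: cvgMr_tmp.
    apply: (cvg_comp (fun s => t * s) cos); last exact: continuous_cos.
    by apply: cvgMl_tmp; exact: cvg_id.
  apply: (cvg_comp (fun s => t * s) sin); last exact: continuous_sin.
  by apply: cvgMl_tmp; exact: cvg_id.
- exact: igK.
- by move=> s _; apply: nearW => t _; exact: psi_le.
Qed.

Let eseq n : R := n.+1%:R^-1.

Let eseq_gt0 n : 0 < eseq n. Proof. by rewrite invr_gt0. Qed.

Let damp_cvg x : damp (eseq n) x @[n --> \oo] --> inv_density x.
Proof.
apply: cvgMl_tmp; apply: fine_cvg.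
rewrite fineK; last exact: integrable_fin_num (ipsi x).
have [|||||_ _] := @dominated_convergence _ _ _ mu `[0%R, +oo[%classic
  (measurable_itv _)
  (fun n t => (expR (- (eseq n * t)) * psi x t)%:E) (fun t => (psi x t)%:E)
  (fun t => (K * (oneDsqr t)^-1)%:E); last by [].
- move=> n; have [||+ _] // := @bound_psi (fun t => expR (- (eseq n * t))) x.
    by move=> t; exact: expR_le1.
  by move/measurable_int.
- exact: measurable_int (ipsi x).
- apply: nearW => t _; apply: cvg_EFin; first exact: nearW.
  rewrite -[X in _ --> X]mul1r; apply: cvgMr_tmp.
  rewrite -expR0 -oppr0 -(mul0r t).
  apply: (cvg_comp (fun n => - (eseq n * t)) expR); last exact: continuous_expR.
  by apply: cvgN; apply: cvgMr_tmp; exact: cvg_harmonic.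
- exact: igK.
- apply: nearW => t n; rewrite /= in_itv /= andbT => t0; rewrite lee_fin.
  apply: le_trans (psi_le x t); rewrite normrM ler_piMl //; exact: expR_le1.
Qed.

Lemma inv_density_ge0 x : 0 <= inv_density x.
Proof.
apply: (cvgr_to_ge (@damp_cvg x)); apply: nearW => n; rewrite dampE //.
by apply: Rintegral_ge0 => w _; exact: cauchy_ge0.
Qed.

Let M_ge0 : 0 <= M. Proof. exact: le_trans (inv_density_le 0). Qed.

Let integrable_bounded_itv (f : R -> R) u v : continuous f ->
  (forall x, `|f x| <= M) -> mu.-integrable `[u, v] (EFin \o f).
Proof.
move=> cf fM; apply: measurable_bounded_integrable => //.
- by rewrite /= lebesgue_measure_itv; case: ifP; rewrite ?ltry // -EFinD ltry.
- by apply: measurable_funTS; exact: continuous_measurable_fun.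
- exists M; split; first exact: num_real.
  by move=> r Mr x _; exact: le_trans (fM x) (ltW Mr).
Qed.

Let step eps u v y : R := pi^-1 * (atan ((v - y) / eps) - atan ((u - y) / eps)).

Let integral_cauchy eps u v y : 0 < eps -> u < v ->
  (\int[mu]_(x in `[u, v]) (cauchy eps (y - x))%:E = (step eps u v y)%:E)%E.
Proof.
move=> eps0 uv; pose F x := pi^-1 * atan ((x - y) / eps).
have dF x : is_derive x (1 : R) F (cauchy eps (y - x)).
  have d1 : is_derive x (1 : R) (fun s => (s - y) / eps) eps^-1.
    have := is_deriveM (is_deriveB (is_derive_id x (1 : R)) (is_derive_cst y x (1 : R)))
      (is_derive_cst eps^-1 x (1 : R)).
    move/is_derive_eq; apply.
    by rewrite scaler0 add0r subr0 /GRing.scale /= mulr1.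
  have := is_deriveZ pi^-1 (is_derive1_comp (is_derive1_atan _) d1).
  move/is_derive_eq; apply; rewrite /GRing.scale /= /cauchy.
  congr (_ * _); field.
  rewrite (gt_eqF eps0) andbT gt_eqF // ltr_pwDl ?exprn_gt0 ?sqr_ge0 //.
have cF : continuous F.
  by move=> x; have [h _] := dF x; exact/differentiable_continuous/derivable1_diffP.
rewrite (@continuous_FTC2 _ _ F) //.
- by rewrite -EFinB /F /step; congr EFin; ring.
- apply: continuous_subspaceT => x.
  apply: (cvg_comp (fun s => y - s) (cauchy eps)); last exact: continuous_cauchy.
  by apply: cvgB; [exact: cvg_cst | exact: cvg_id].
- split; first by move=> x _; have [] := dF x.
    by apply: cvg_at_right_filter; exact: cF.
  by apply: cvg_at_left_filter; exact: cF.
- by move=> x _; rewrite derive1E; have [_ ->] := dF x.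
Qed.

Let integral_damp eps u v : 0 < eps -> u < v ->
  (\int[mu]_(x in `[u, v]) (damp eps x)%:E = \int[P]_w (step eps u v (X w))%:E)%E.
Proof.
move=> eps0 uv.
transitivity (\int[mu]_(x in `[u, v]) \int[P]_w (cauchy eps (X w - x))%:E)%E.
  apply: eq_integral => x _; rewrite dampE // /Rintegral fineK //.
  exact: integrable_fin_num (icauchy x eps0).
rewrite (@fubini_bounded _ _ (cst (pi^-1 / eps))) //.
- by apply: eq_integral => w _; exact: integral_cauchy.
- apply: measurableT_comp.
    by apply: continuous_measurable_fun; exact: continuous_cauchy.
  by apply: measurable_funB => //; exact: measurableT_comp.
- apply: measurable_bounded_integrable => //.
    by rewrite /= lebesgue_measure_itv; case: ifP; rewrite ?ltry // -EFinD ltry.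
  exists (pi^-1 / eps); split; first exact: num_real.
  move=> r Mr x _; apply: le_trans (ltW Mr).
  by rewrite ger0_norm // divr_ge0 ?invr_ge0 ?pi_ge0 // ltW.
- by move=> x w _; exact: cauchy_le.
Qed.

(** The indicator of [u, v], with value 1/2 at the end points. *)
Let jump u v y : R := (Num.sg (v - y) - Num.sg (u - y)) / 2.

Let step_cvg u v y : step (eseq n) u v y @[n --> \oo] --> jump u v y.
Proof.
have atan_cvg z : atan (z / eseq n) @[n --> \oo] --> pi / 2 * Num.sg z.
  have pos z' : 0 < z' -> atan (z' / eseq n) @[n --> \oo] --> pi / 2.
    move=> z0; rewrite /eseq; under eq_fun do rewrite invrK.
    apply: (@cvg_comp _ _ _ (fun n => n.+1%:R : R) (fun r => atan (z' * r))
      \oo (pinfty_nbhs R)).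
      by have := @cvgr_idn R; rewrite -cvg_shiftS.
    apply: (cvg_comp (fun r => z' * r) atan); last exact: cvgy_atan.
    by apply: gt0_cvgMry => //; exact: cvg_id.
  have [z0|z0|->] := ltgtP z 0.
  - rewrite ltr0_sg // mulrN1 -(opprK z).
    under eq_fun do rewrite mulNr atanN.
    by apply: cvgN; apply: pos; rewrite oppr_gt0.
  - by rewrite gtr0_sg // mulr1; exact: pos.
  - by under eq_fun do rewrite mul0r atan0; rewrite sgr0 mulr0; exact: cvg_cst.
have -> : jump u v y = pi^-1 * (pi / 2 * Num.sg (v - y) - pi / 2 * Num.sg (u - y)).
  rewrite /jump; have := lt0r_neq0 (pi_gt0 R); move: (pi : R) => p p0.
  by field.
by rewrite /step; apply: cvgMl_tmp; apply: cvgB; exact: atan_cvg.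
Qed.

Let mstep u v n : measurable_fun setT (fun w => (step (eseq n) u v (X w))%:E).
Proof.
apply/measurable_EFinP; apply: measurable_funM => //.
have m1 z : measurable_fun setT (fun w => atan ((z - X w) / eseq n)).
  apply: measurableT_comp.
    exact: (continuous_measurable_fun (@continuous_atan R)).
  by apply: measurable_funM => //; apply: measurable_funB.
exact: measurable_funB.
Qed.

Let mjump u v : measurable_fun setT (fun w => (jump u v (X w))%:E).
Proof.
apply: (@emeasurable_fun_cvg _ _ _ _
  (fun n w => (step (eseq n) u v (X w))%:E)) => [n|w _]; first exact: mstep.
by apply: cvg_EFin; [exact: nearW | exact: step_cvg].
Qed.

(** Dominated convergence on both sides of [integral_damp]. *)
Let integral_inv_density u v : u < v ->
  (\int[mu]_(x in `[u, v]) (inv_density x)%:E = \int[P]_w (jump u v (X w))%:E)%E.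
Proof.
move=> uv; have step_le n y : `|step (eseq n) u v y| <= 1.
  have := atan_ltpi2 ((v - y) / eseq n); have := atan_gtNpi2 ((v - y) / eseq n).
  have := atan_ltpi2 ((u - y) / eseq n); have := atan_gtNpi2 ((u - y) / eseq n).
  rewrite /step normrM ger0_norm ?invr_ge0 ?pi_ge0 // ler_pdivrMl ?pi_gt0 // mulr1.
  by move=> h1 h2 h3 h4; rewrite ler_norml; apply/andP; split; lra.
have cvgP' w : (step (eseq n) u v (X w))%:E @[n --> \oo] --> (jump u v (X w))%:E.
  by apply: cvg_EFin; [exact: nearW | exact: step_cvg].
have [|||||_ _ c1] := @dominated_convergence _ _ _ P setT measurableT
  (fun n w => (step (eseq n) u v (X w))%:E) (fun w => (jump u v (X w))%:E) (cst 1%E).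
- exact: mstep.
- exact: mjump.
- by apply: nearW => w _; exact: cvgP'.
- exact: finite_measure_integrable_cst.
- by apply: nearW => w n _; rewrite lee_fin.
have [|||||_ _ c2] := @dominated_convergence _ _ _ mu `[u, v]%classic (measurable_itv _)
  (fun n x => (damp (eseq n) x)%:E) (fun x => (inv_density x)%:E) (cst M%:E).
- move=> n; apply/measurable_EFinP; apply: measurable_funTS.
  by apply: continuous_measurable_fun; exact: continuous_damp.
- apply/measurable_EFinP; apply: measurable_funTS.
  by apply: continuous_measurable_fun; exact: continuous_inv_density.
- apply: nearW => x _; apply: cvg_EFin; [exact: nearW | exact: damp_cvg].
- apply: (@integrable_bounded_itv (cst M)); first exact: cst_continuous.
  by move=> x; rewrite ger0_norm.
- by apply: nearW => x n _; rewrite lee_fin; exact: damp_le.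
apply: (cvg_unique _ c2) => //; apply: cvg_trans c1; apply: near_eq_cvg.
by apply: nearW => n; rewrite /= integral_damp.
Qed.

Let jump_ge0 u v y : u < v -> 0 <= jump u v y.
Proof.
move=> uv; rewrite /jump divr_ge0 // subr_ge0.
case: (sgrP (v - y)) => h1; case: (sgrP (u - y)) => h2 //; lra.
Qed.

Let jump_le1 u v y : jump u v y <= 1.
Proof.
rewrite /jump ler_pdivrMr // mul1r.
case: (sgrP (v - y)) => _; case: (sgrP (u - y)) => _; lra.
Qed.

Let jump_in u v y : u < y -> y < v -> jump u v y = 1.
Proof.
move=> uy yv; rewrite /jump gtr0_sg ?subr_gt0 // ltr0_sg ?subr_lt0 //; lra.
Qed.

Let jump_out u v y : u < v -> (y < u) || (v < y) -> jump u v y = 0.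
Proof.
move=> uv /orP[h|h].
  have h1 : 0 < v - y by rewrite subr_gt0 (lt_trans h).
  have h2 : 0 < u - y by rewrite subr_gt0.
  by rewrite /jump !gtr0_sg // subrr mul0r.
have h1 : v - y < 0 by rewrite subr_lt0.
have h2 : u - y < 0 by rewrite subr_lt0 (lt_trans uv).
by rewrite /jump !ltr0_sg // subrr mul0r.
Qed.

Let distE A : measurable A ->
  distribution P X A = (\int[P]_w (\1_A (X w))%:E)%E.
Proof.
move=> mA; have mXA : measurable (X @^-1` A) by exact: measurable_funPTI.
rewrite /distribution /pushforward -[X in P X]setIT -(integral_indic P measurableT mXA).
by apply: eq_integral => w _; rewrite /= !indicE.
Qed.

Let mind A : measurable A -> measurable_fun setT (fun w => (\1_A (X w))%:E : \bar R).
Proof.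
by move=> mA; apply/measurable_EFinP; apply: measurableT_comp.
Qed.

Let mdens A : measurable_fun A (EFin \o inv_density).
Proof.
apply: measurable_funTS; apply/measurable_EFinP.
by apply: continuous_measurable_fun; exact: continuous_inv_density.
Qed.

Let dens_ge0 x : (0 <= (inv_density x)%:E)%E.
Proof. by rewrite lee_fin inv_density_ge0. Qed.

Let integral_dens_le (i : interval R) (l : R) : lebesgue_measure [set` i] = l%:E ->
  (\int[mu]_(x in [set` i]) (inv_density x)%:E <= (M * l)%:E)%E.
Proof.
move=> il; rewrite EFinM -il -integral_cst //.
apply: ge0_le_integral => //.
- exact: mdens.
- by move=> x _; rewrite lee_fin (le_trans (ler_norm _)) // inv_density_le.
Qed.

(** Widening the interval by [dl] absorbs a possible atom at the end point; the
    density being bounded by [M], the price is at most [M * dl]. *)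
Let dist_itv_le u v (dl : R) : u < v -> 0 < dl ->
  (distribution P X `]u, v]
   <= \int[mu]_(x in `]u, v]) (inv_density x)%:E + (M * dl)%:E)%E.
Proof.
move=> uv dl0; have uvd : u < v + dl by rewrite ltr_wpDr // ltW.
rewrite distE //.
apply: (@le_trans _ _ (\int[P]_w (jump u (v + dl) (X w))%:E)%E).
  apply: ge0_le_integral => //.
  - exact: mind.
  - move=> w _; rewrite lee_fin indicE.
    case: (boolP (X w \in _)) => [|_]; last exact: jump_ge0.
    rewrite inE /= in_itv /= => /andP[h1 h2].
    by rewrite jump_in // (le_lt_trans h2) // ltrDl.
rewrite -integral_inv_density // -integral_itv_obnd_cbnd; last exact: mdens.
rewrite (@itv_bndbnd_setU _ _ (BRight u) (BRight v) (BRight (v + dl))); last 2 first.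
- by rewrite bnd_simp ltW.
- by rewrite bnd_simp lerDl ltW.
rewrite ge0_integral_setU //=; last 2 first.
- exact: mdens.
- by apply: lt_disjoint => x y; rewrite !in_itv /= => /andP[_ h1] /andP[h2 _];
    exact: le_lt_trans h1 h2.
apply: leeD => //; apply: integral_dens_le.
by rewrite lebesgue_measure_itv /= lte_fin ltrDl dl0 -EFinB addrAC subrr add0r.
Qed.

Let dist_itv_ge u v (dl : R) : 0 < dl -> u + dl < v ->
  (\int[mu]_(x in `]u, v]) (inv_density x)%:E
   <= distribution P X `]u, v] + (M * dl)%:E)%E.
Proof.
move=> dl0 udv; have uv : u < v by apply: le_lt_trans udv; rewrite lerDl ltW.
rewrite (@itv_bndbnd_setU _ _ (BRight u) (BRight (u + dl)) (BRight v)); last 2 first.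
- by rewrite bnd_simp lerDl ltW.
- by rewrite bnd_simp ltW.
rewrite ge0_integral_setU //=; last 2 first.
- exact: mdens.
- by apply: lt_disjoint => x y; rewrite !in_itv /= => /andP[_ h1] /andP[h2 _];
    exact: le_lt_trans h1 h2.
rewrite addeC; apply: leeD; last first.
  apply: integral_dens_le.
  by rewrite lebesgue_measure_itv /= lte_fin ltrDl dl0 -EFinB addrAC subrr add0r.
rewrite integral_itv_obnd_cbnd; last exact: mdens.
rewrite integral_inv_density //.
rewrite -itv_bndbnd_setU ?bnd_simp ?lerDl ?(ltW dl0) ?(ltW udv) // distE //.
apply: ge0_le_integral => //.
- by move=> w _; rewrite lee_fin jump_ge0.
- exact: mind.
move=> w _; rewrite lee_fin indicE.
case: (boolP (X w \in _)) => [_|]; first exact: jump_le1.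
move=> /negP h; rewrite jump_out //; apply/orP.
have [h1|h1] := ltP (X w) (u + dl); first by left.
right; rewrite ltNge; apply/negP => h2; apply: h.
by rewrite inE /= in_itv /= h2 andbT (lt_le_trans _ h1) // ltrDl.
Qed.

(** The law of [X] and the measure of density [inv_density] agree on the
    half-open intervals, which generate the Borel sets. *)
Lemma char_fun_inversion : has_bounded_continuous_density (distribution P X).
Proof.
have mf : measurable_fun setT inv_density.
  by apply: continuous_measurable_fun; exact: continuous_inv_density.
exists inv_density; split.
- exact: inv_density_ge0.
- exact: continuous_inv_density.
- by exists M; exact: inv_density_le.
pose nu := density_measure inv_density_ge0 mf.
have M1 : 0 < M + 1 by rewrite ltr_wpDl.
have key u v : distribution P X `]u, v]%classic = nu `]u, v]%classic.
  have [uv|vu] := ltP u v; last by rewrite set_itv_ge ?bnd_simp -?leNgt // !measure0.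
  apply/eqP; rewrite eq_le; apply/andP; split; apply/lee_addgt0Pr => e e0.
    apply: (le_trans (dist_itv_le uv (divr_gt0 e0 M1))); apply: leeD => //.
    rewrite lee_fin mulrA ler_pdivrMr // mulrC ler_wpM2l ?(ltW e0) //.
    by rewrite lerDl.
  pose dl := Num.min (e / (M + 1)) ((v - u) / 2).
  have dl0 : 0 < dl by rewrite lt_min !divr_gt0 // subr_gt0.
  have udv : u + dl < v.
    have : dl <= (v - u) / 2 by rewrite ge_min lexx orbT.
    by move: uv; lra.
  apply: (le_trans (dist_itv_ge dl0 udv)); apply: leeD => //.
  rewrite lee_fin; apply: (@le_trans _ _ (M * (e / (M + 1)))).
    by rewrite ler_wpM2l // ge_min lexx.
  rewrite mulrA ler_pdivrMr // mulrC ler_wpM2l ?(ltW e0) //.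
  by rewrite lerDl.
move=> A mA; rewrite -[RHS]/(nu A).
apply: (measure_unique (@ocitv R) (fun n => `](- n%:R), n%:R]%classic)) => //.
- exact: ocitvI.
- by move=> n; exact: is_ocitv.
- apply/seteqP; split => // x _; exists (Num.truncn `|x|).+1 => //=.
  have h : `|x| < (Num.truncn `|x|).+1%:R by exact: truncnS_gt.
  by rewrite in_itv /=; move: h; rewrite ltr_norml => /andP[-> /ltW ->].
- by move=> _ [[u v] _ <-]; exact: key.
- move=> n; apply: le_lt_trans (probability_le1 _ _) _ => //.
  by rewrite ltry.
Qed.

End inversion.

(** * Laws of the elementary limits *)

Section urn_limit_regularity.
Variable R : realType.
Variables a b c d : nat.
Hypothesis balanced : (a + b = c + d)%N.
Hypothesis nontriangular : (b * c <> 0)%N.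
Hypothesis large : urn_S R a b / 2 < urn_m R a c < urn_S R a b.
Variables (disp : measure_display) (T : measurableType disp).
Variables (P : probability T R) (D : nat -> {RV P >-> bool}).
Variable e : nat * nat.
Hypothesis ee : elementary e.
Hypothesis drawsD : urn_draws a b c d e D.
Variable W : {RV P >-> R}.
Hypothesis limW : urn_limit a b c d e D W.
Local Notation normc := ComplexField.Normc.normc.

Let char_le1 t : normc (char_fun W t) <= 1.
Proof.
apply: (urn_limit_char_le drawsD limW) => //.
by apply: nearW => n; exact: urn_char_le1.
Qed.

Lemma urn_limit_decay (rho : R) : 0 < rho -> exists C : R, 0 < C /\
  forall t : R, t != 0 -> normc (char_fun W t) <= C / `|t| `^ rho.
Proof.
move=> rho0; have [C C0 hC] := urn_char_decay balanced nontriangular large ee rho0.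
exists (Num.max C 1); split=> [|t t0]; first by rewrite lt_max C0.
have tp : 0 < `|t| `^ rho by rewrite powR_gt0 // normr_gt0.
have [t1|t1] := lerP 1 `|t|.
  apply: (@le_trans _ _ (C / `|t| `^ rho)).
    apply: (urn_limit_char_le drawsD limW); last exact: hC.
    by rewrite divr_ge0 // ltW.
  by rewrite ler_pM2r ?invr_gt0 // le_max lexx.
apply: (le_trans (char_le1 t)); rewrite ler_pdivlMr // mul1r.
apply: (@le_trans _ _ 1); last by rewrite le_max lexx orbT.
apply: (@le_trans _ _ (1 `^ rho)); last by rewrite powR1.
by rewrite ge0_ler_powR ?nnegrE // ltW.
Qed.

(** The decay of exponent 2, together with the bound 1 near 0, makes the
    characteristic function integrable. *)
Lemma urn_limit_density : has_bounded_continuous_density (distribution P W).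
Proof.
have [C [C0 hC]] := urn_limit_decay (ltr0n R 2).
apply: (@char_fun_inversion R _ _ P W (2 * (C + 1))) => t.
rewrite -[leRHS]/(_ / _) ler_pdivlMr ?(lt_le_trans ltr01 (oneDsqr_ge1 t)) // /oneDsqr.
have h1 := char_le1 t.
have h2 : normc (char_fun W t) * t ^+ 2 <= C.
  have [->|t0] := eqVneq t 0; first by rewrite expr0n mulr0 ltW.
  have := hC t t0; rewrite powR_mulrn // real_normK ?num_real // ler_pdivlMr //.
  by rewrite exprn_even_gt0.
by rewrite mulrDr mulr1; lra.
Qed.

End urn_limit_regularity.

Lemma density_dominates (R : realType) (m : set R -> \bar R) :
  has_bounded_continuous_density m -> m `<< lebesgue_measure.
Proof.
move=> [f [f0 cf [M fM] mE]] N N0 A mA AN; rewrite mE //.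
apply/eqP; rewrite eq_le; apply/andP; split; last first.
  by apply: integral_ge0 => x _; rewrite lee_fin.
apply: (@le_trans _ _ (\int[lebesgue_measure]_(x in A) (cst M%:E x))%E).
  apply: ge0_le_integral => //.
  - by move=> x _; rewrite lee_fin.
  - apply/measurable_EFinP; apply: measurable_funTS.
    exact: continuous_measurable_fun.
  - by move=> x _; rewrite lee_fin; apply: le_trans (fM x); exact: ler_norm.
rewrite integral_cst // [X in (_ * X)%E](_ : _ = 0%E) ?mule0 //.
exact: N0 A mA AN.
Qed.

Theorem theorem6 (R : realType) (a b c d : nat)
    (balanced : (a + b = c + d)%N)
    (nontriangular : (b * c <> 0)%N)
    (large : urn_S R a b / 2 < urn_m R a c < urn_S R a b)
    (dispX : measure_display) (TX : measurableType dispX)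
    (PX : probability TX R) (DX : nat -> {RV PX >-> bool})
    (urnX : urn_draws a b c d (1, 0)%N DX)
    (X : {RV PX >-> R}) (limX : urn_limit a b c d (1, 0)%N DX X)
    (dispY : measure_display) (TY : measurableType dispY)
    (PY : probability TY R) (DY : nat -> {RV PY >-> bool})
    (urnY : urn_draws a b c d (0, 1)%N DY)
    (Y : {RV PY >-> R}) (limY : urn_limit a b c d (0, 1)%N DY Y) :
  (measure_support (distribution PX X) = setT /\
   measure_support (distribution PY Y) = setT) /\
  (forall rho : R, 0 < rho < (a%:R + 1) / urn_m R a c ->
     exists C : R, 0 < C /\
       forall t : R, t != 0 ->
         ComplexField.Normc.normc (char_fun X t) <= C / (`|t| `^ rho)) /\
  (forall rho : R, 0 < rho < (d%:R + 1) / urn_m R a c ->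
     exists C : R, 0 < C /\
       forall t : R, t != 0 ->
         ComplexField.Normc.normc (char_fun Y t) <= C / (`|t| `^ rho)) /\
  (distribution PX X `<< lebesgue_measure /\
   distribution PY Y `<< lebesgue_measure /\
   has_bounded_continuous_density (distribution PX X) /\
   has_bounded_continuous_density (distribution PY Y)).
Proof.
have eX : elementary (1, 0)%N by left.
have eY : elementary (0, 1)%N by right.
have dX := urn_limit_density balanced nontriangular large eX urnX limX.
have dY := urn_limit_density balanced nontriangular large eY urnY limY.
split; [split|split; [|split]].
- exact: (urn_limit_support balanced nontriangular large eX urnX limX).
- exact: (urn_limit_support balanced nontriangular large eY urnY limY).
- move=> rho /andP[rho0 _].
  exact: (urn_limit_decay balanced nontriangular large eX urnX limX rho0).
- move=> rho /andP[rho0 _].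
  exact: (urn_limit_decay balanced nontriangular large eY urnY limY rho0).
- by do 2?[split; first exact: density_dominates].
Qed.
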